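(* Let $A\in\mathbb{R}^{n\times n}$ and $B\in\mathbb{R}^{n\times m}$, and assume that the pair $(A,B)$ is stabilizable but not controllable. Let $A_{\rm u}$ be the uncontrollable block of an orthogonal Kalman decomposition of $(A,B)$, let $$\delta_*:=-\max\{\operatorname{Re}\lambda:\lambda\in\sigma(A_{\rm u})\}>0,$$ and let $q$ be the largest size of a Jordan block in the complex Jordan form of $A_{\rm u}$ associated with an eigenvalue $\lambda$ satisfying $\operatorname{Re}\lambda=-\delta_*$. Then there exist constants $c_0,C_0,\varepsilon_0>0$, depending only on $(A,B)$, such that $$c_0(\delta_*-\delta)^{-(q-1)}\le\widehat C(\delta)\le C_0(\delta_*-\delta)^{-(q-1)}\qquad\text{for all }\delta>0\text{ with }0<\delta_*-\delta\le\varepsilon_0.$$ Moreover, $$q=1+\lim_{\delta\uparrow\delta_*}\frac{\log\widehat C(\delta)}{\log\bigl(1/(\delta_*-\delta)\bigr)}.$$ Finally, the endpoint $\delta_*$ itself is achievable if and only if $q=1$; equivalently, $$\widehat C(\delta_* )<+\infty\iff q=1.$$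
   Context: $\mathbb{R}^n$ carries the Euclidean norm and $\|\cdot\|$ also denotes the induced operator norm on matrices; $\sigma(\cdot)$ denotes the (complex) spectrum. The pair $(A,B)$ is controllable if $\operatorname{rank}[B,AB,\ldots,A^{n-1}B]=n$, and stabilizable if there is $K\in\mathbb{R}^{m\times n}$ such that all eigenvalues of $A+BK$ have negative real part. For $\delta>0$ the optimal stabilization prefactor of $(A,B)$ is $$\widehat C(\delta):=\inf_{K\in\mathbb{R}^{m\times n}}\ \sup_{t\ge 0}\ e^{\delta t}\,\|e^{(A+BK)t}\|\in[1,+\infty].$$ A rate $\delta>0$ is achievable if there is $K\in\mathbb{R}^{m\times n}$ with $\sup_{t\ge0}e^{\delta t}\|e^{(A+BK)t}\|<+\infty$. Orthogonal Kalman decomposition: let $\mathcal R=\operatorname{Ran}[B,AB,\ldots,A^{n-1}B]$, $n_{\rm c}=\dim\mathcal R$, $n_{\rm u}=n-n_{\rm c}\ge 1$. Let $Q=(Q_{\rm c},Q_{\rm u})\in\mathbb{R}^{n\times n}$ be orthogonal, where the columns of $Q_{\rm c}$ and $Q_{\rm u}$ are orthonormal bases of $\mathcal R$ and $\mathcal R^\perp$, respectively. Then $$Q^\top AQ=\begin{pmatrix}A_{\rm c}&A_{\rm cu}\\0&A_{\rm u}\end{pmatrix},\qquad Q^\top B=\begin{pmatrix}B_{\rm c}\\0\end{pmatrix},$$ with $A_{\rm u}=Q_{\rm u}^\top AQ_{\rm u}\in\mathbb{R}^{n_{\rm u}\times n_{\rm u}}$ the uncontrollable block (if $n_{\rm c}=0$,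 the blocks with index c are absent and $A_{\rm u}$ is the whole matrix). The spectrum and Jordan block sizes of $A_{\rm u}$ do not depend on the choice of $Q$, and $A_{\rm u}$ is Hurwitz since $(A,B)$ is stabilizable. *)

(* Defs.v *)
From mathcomp Require Import all_boot all_order all_algebra.
From mathcomp Require Import complex.
From mathcomp Require Import all_classical all_reals all_analysis.

Set Implicit Arguments.
Unset Strict Implicit.
Unset Printing Implicit Defensive.

Import Order.TTheory GRing.Theory Num.Theory.
Import numFieldNormedType.Exports.

Local Open Scope classical_set_scope.
Local Open Scope complex_scope.
Local Open Scope ring_scope.

Section MatrixAnalysis.
Variable R : realType.

Definition enorm n (x : 'cV[R]_n) : R := Num.sqrt (\sum_i x i 0 ^+ 2).

(* Since 0 belongs to the unit ball and a linear map is bounded on it, the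
   real-valued [sup] is a genuine supremum. *)
Definition opnorm m n (M : 'M[R]_(m, n)) : R :=
  sup [set enorm (M *m x) | x in [set x : 'cV[R]_n | enorm x <= 1]].

(* The limit is taken in the (entrywise) topology of 'M[R]_n. *)
Definition expmx n (M : 'M[R]_n) : 'M[R]_n :=
  limn (series (fun k => (k`!%:R)^-1 *: M ^+ k)).

Definition spectrum n (M : 'M[R]_n) : set R[i] :=
  [set l | eigenvalue (map_mx (real_complex R) M) l].

(* For n > 0 the spectrum is finite and nonempty, so this supremum is the
   maximum of the real parts of the eigenvalues. *)
Definition spectral_abscissa n (M : 'M[R]_n) : R :=
  sup [set complex.Re l | l in spectrum M].

End MatrixAnalysis.

Section JordanForm.
Variable F : fieldType.

Definition jordan_block (l : F) (k : nat) : 'M[F]_k :=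
  \matrix_(i, j) (l *+ (i == j) + (j == i.+1 :> nat)%:R).

(* M has a Jordan form with r blocks, the i-th one having eigenvalue l i and
   size s i > 0. Writing the base change P with an explicit two-sided inverse
   P' forces n = \sum_i s i without any cast between the two dimensions. *)
Definition is_jordan_form n (M : 'M[F]_n) r (l : 'I_r -> F) (s : 'I_r -> nat) :
    Prop :=
  (forall i, (0 < s i)%N) /\
  exists (P : 'M[F]_(n, \sum_i s i)) (P' : 'M[F]_(\sum_i s i, n)),
    [/\ P *m P' = 1%:M, P' *m P = 1%:M
      & P' *m M *m P = \mxdiag_i jordan_block (l i) (s i)].

End JordanForm.

Section Control.
Variables (R : realType) (n m : nat).
Implicit Types (A : 'M[R]_n) (B : 'M[R]_(n, m)).

Definition ctrb_mx A B : 'M[R]_(n, \sum_(k < n) m) :=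
  \mxrow_(k < n) (A ^+ k *m B).

Definition controllable A B : Prop := \rank (ctrb_mx A B) = n.

Definition stabilizable A B : Prop :=
  exists K : 'M[R]_(m, n),
    forall l : R[i], spectrum (A + B *m K) l -> complex.Re l < 0.

(* The columns of Qc and Qu are orthonormal bases of the range of [ctrb_mx A B]
   and of its orthogonal complement. Subspaces are row spaces in mathcomp, hence
   the transposes; [kermx C] represents the row vectors u with u *m C = 0, that
   is, the orthogonal complement of the range of C. The two conditions force
   nc = \rank (ctrb_mx A B) and nu = n - nc. *)
Definition is_orthogonal_kalman A B nc nu
    (Qc : 'M[R]_(n, nc)) (Qu : 'M[R]_(n, nu)) : Prop :=
  [/\ Qc^T *m Qc = 1%:M, (Qc^T == (ctrb_mx A B)^T)%MS,
      Qu^T *m Qu = 1%:M & (Qu^T == kermx (ctrb_mx A B))%MS].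

Definition decay_prefactor (d : R) (M : 'M[R]_n) : \bar R :=
  ereal_sup [set (expR (d * t) * opnorm (expmx (t *: M)))%:E
            | t in [set t : R | 0 <= t]].

Definition opt_prefactor A B (d : R) : \bar R :=
  ereal_inf [set decay_prefactor d (A + B *m K) | K in [set: 'M[R]_(m, n)]].

Definition achievable A B (d : R) : Prop :=
  exists K : 'M[R]_(m, n), (decay_prefactor d (A + B *m K) < +oo)%E.

End Control.

Definition uncontrollable_block (R : realType) n nu
    (A : 'M[R]_n) (Qu : 'M[R]_(n, nu)) : 'M[R]_nu :=
  Qu^T *m A *m Qu.

(* The largest size among the blocks (l i, s i) with Re (l i) = a. *)
Definition max_block_size (R : realType) r (l : 'I_r -> R[i])
    (s : 'I_r -> nat) (a : R) : nat :=
  \max_(i < r | complex.Re (l i) == a) s i.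

(* Main.v *)
Require Import Defs.
From mathcomp Require Import all_boot all_order all_algebra.
From mathcomp Require Import complex polyrcf.
From mathcomp Require Import all_classical all_reals all_analysis.
From mathcomp Require Import ring lra.
Import Order.TTheory GRing.Theory Num.Theory.
Import numFieldNormedType.Exports.
Set Implicit Arguments.
Unset Strict Implicit.
Unset Printing Implicit Defensive.
Local Open Scope classical_set_scope.
Local Open Scope complex_scope.
Local Open Scope ring_scope.

(** Write [X t = expmx (t *: (A + B *m K))] and [p = q - 1]. Feedback cannot
    touch the uncontrollable block [Au]: since [Qu^T *m B = 0] and
    [Qu^T *m A = Au *m Qu^T], every closed loop satisfies
    [Qu^T *m (A + B *m K) = Au *m Qu^T]. A left Jordan chain of [Au] thus pulls
    back along [Qu^T] to a left Jordan chain of [A + B *m K], the same for all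
    [K], and along such a chain the equation X' = (A + BK) X integrates to
    exp (l t) times a polynomial in t ([jordan_chain_expmx]). Both bounds on
    the optimal prefactor come from this.

    Lower bound ([growth_lower_bound]): a chain of length [q] on the critical
    line Re l = - dstar yields a fixed bilinear form of [X t] of modulus
    t^p exp (- dstar t) / p!, so the norm of [X t] is at least
    c t^p exp (- dstar t), with [c] independent of [K]. For
    e = dstar - d > 0, taking t = 1 / e gives the bound c exp(-1) e^-p. For
    d > dstar, or d = dstar and p > 0, letting t grow shows that the prefactor
    is infinite for every [K].

    Upper bound ([growth_upper_bound]): one single [K] serves for all d. The
    vectors (A - mu)^-1 B u, with mu ranging over n distinct reals at most
    - dstar - 1, span the reachable subspace ([resolvent_kernel]); a basis
    extracted from them is turned into eigenvectors by a suitable [K]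
    ([assign_reachable_eigenvalues]). In these coordinates the reachable
    components of [X t] satisfy scalar equations y' = mu y + g, where the
    forcing term g comes from [Qu^T *m X t] and is O((1 + t)^p exp (- dstar t))
    by the chain formula; as mu <= - dstar - 1, y has the same growth
    ([linear_ode_dominated]). Finally (1 + t)^p exp (- e t) = O(e^-p) for
    e <= 1 ([polynomial_le_exp]), and for p = 0 the endpoint d = dstar gives a
    finite prefactor.

    The limit follows by taking logarithms ([log_ratio_cvg]). The constants
    must not depend on the decomposition nor on the Jordan form; this holds
    because the optimal prefactor alone determines [dstar], as the rate beyond
    which it is infinite, and [q], through the limit
    ([prefactor_law_unique]). *)

(** * Differential calculus on the real line *)

Section Derivatives.
Variable R : realType.
Implicit Types (f g df dg : R -> R) (a b c t : R).

(** Derivatives are carried as explicit functions, so that the differential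
    equations below are statements about a function and its derivative. *)
Definition has_deriv f df := forall t, is_derive t (1 : R) f (df t).

Lemma eq_has_deriv f df dg :
  has_deriv f df -> (forall t, df t = dg t) -> has_deriv f dg.
Proof. by move=> fd e t; rewrite -e. Qed.

Lemma has_derivD f df g dg : has_deriv f df -> has_deriv g dg ->
  has_deriv (fun t => f t + g t) (fun t => df t + dg t).
Proof. by move=> fd gd t; have := fd t; have := gd t => ? ?; apply: is_deriveD. Qed.

Lemma has_derivM f df g dg : has_deriv f df -> has_deriv g dg ->
  has_deriv (fun t => f t * g t) (fun t => df t * g t + f t * dg t).
Proof.
move=> fd gd t; have := fd t; have := gd t => ? ?.
by apply: is_derive_eq; rewrite /GRing.scale/= addrC mulrC.
Qed.

Lemma has_deriv_cst a : has_deriv (fun=> a) (fun=> 0).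
Proof. by move=> t; exact: is_derive_cst. Qed.

Lemma has_derivZ a f df : has_deriv f df ->
  has_deriv (fun t => a * f t) (fun t => a * df t).
Proof.
move=> fd; apply: (eq_has_deriv (has_derivM (has_deriv_cst a) fd)) => t.
by rewrite mul0r add0r.
Qed.

Lemma has_derivB f df g dg : has_deriv f df -> has_deriv g dg ->
  has_deriv (fun t => f t - g t) (fun t => df t - dg t).
Proof. by move=> fd gd t; have := fd t; have := gd t => ? ?; apply: is_deriveB. Qed.

Lemma has_deriv_sum (I : Type) (r : seq I) (F dF : I -> R -> R) :
  (forall i, has_deriv (F i) (dF i)) ->
  has_deriv (fun t => \sum_(i <- r) F i t) (fun t => \sum_(i <- r) dF i t).
Proof.
move=> FdF; elim: r => [|i r IH].
  have := has_deriv_cst 0; set f := (fun=> 0) => h t; rewrite big_nil.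
  by rewrite (_ : (fun _ => _) = f)//; apply/funext => u; rewrite big_nil.
move=> t; rewrite big_cons.
rewrite (_ : (fun _ => _) = (fun u => F i u + \sum_(j <- r) F j u)).
  exact: (has_derivD (FdF i) IH).
by apply/funext => u; rewrite big_cons.
Qed.

Lemma has_deriv_expR a :
  has_deriv (fun t => expR (a * t)) (fun t => a * expR (a * t)).
Proof.
move=> t; apply: trigger_derive.
by rewrite /GRing.scale/=; ring.
Qed.

Lemma has_deriv_cos b :
  has_deriv (fun t => cos (b * t)) (fun t => - b * sin (b * t)).
Proof.
move=> t; apply: trigger_derive.
by rewrite /GRing.scale/=; ring.
Qed.

Lemma has_deriv_sin b :
  has_deriv (fun t => sin (b * t)) (fun t => b * cos (b * t)).
Proof.
move=> t; apply: trigger_derive.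
by rewrite /GRing.scale/=; ring.
Qed.

Lemma has_deriv_id : has_deriv id (fun=> 1).
Proof. by move=> t; exact: is_derive_id. Qed.

Lemma has_deriv_expn n : has_deriv (fun t => t ^+ n.+1) (fun t => n.+1%:R * t ^+ n).
Proof.
elim: n => [|n IH].
  by apply: (eq_has_deriv has_deriv_id) => t; rewrite mulr1.
move=> t; rewrite (_ : (fun _ => _) = (fun u => id u * u ^+ n.+1)).
  apply: (eq_has_deriv (dg := fun t => n.+2%:R * t ^+ n.+1) (has_derivM has_deriv_id IH)) => u.
  by rewrite (exprS u n) -[in RHS]natr1; ring.
by apply/funext => u; rewrite exprS.
Qed.

Lemma has_deriv_taylor_monomial n :
  has_deriv (fun t => t ^+ n.+1 / n.+1`!%:R) (fun t => t ^+ n / n`!%:R).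
Proof.
move=> t; rewrite (_ : (fun _ => _) = (fun u => n.+1`!%:R^-1 * u ^+ n.+1)); last first.
  by apply/funext => u; rewrite mulrC.
apply: (eq_has_deriv (has_derivZ _ (has_deriv_expn n)) (dg := fun t => t ^+ n / n`!%:R)) => u.
have n1 : n.+1%:R != 0 :> R by rewrite pnatr_eq0.
by rewrite factS natrM invfM mulrACA mulVf// mul1r mulrC.
Qed.

Lemma has_deriv0_cst f : has_deriv f (fun=> 0) -> forall t, f t = f 0.
Proof. by move=> fd t; exact: is_derive_0_is_cst. Qed.

Lemma has_deriv_ge0 f df : has_deriv f df -> (forall t, 0 <= t -> 0 <= df t) ->
  forall t, 0 <= t -> f 0 <= f t.
Proof.
move=> fd df0 t t0.
have dvf x : derivable f x 1 by have := fd x; case.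
apply: (@ger0_derive1_ndecry R f 0) => //.
- move=> x; rewrite in_itv/= andbT => x0.
  by have fdx := fd x; rewrite derive1E derive_val df0// ltW.
- apply: continuous_subspaceT => x.
  by apply: differentiable_continuous; apply/derivable1_diffP.
Qed.

(** A chain f_k' = f_(k+1) ending in 0 consists of polynomials, so each f_k is
    its own Taylor expansion at 0. *)
Lemma taylor_chain (s : nat) (f : nat -> R -> R) :
  (forall k, (k < s)%N -> has_deriv (f k) (f k.+1)) -> (forall t, f s t = 0) ->
  forall k t, (k <= s)%N ->
    f k t = \sum_(j < s - k) f (k + j)%N 0 * (t ^+ j / j`!%:R).
Proof.
move=> fd fs k t ks.
suff H : forall d, forall k t, (k <= s)%N -> (s - k)%N = d ->
    f k t = \sum_(j < d) f (k + j)%N 0 * (t ^+ j / j`!%:R) by exact: H.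
elim=> [|d IH] {ks}k {}t ks e.
  have -> : k = s by apply/eqP; rewrite eqn_leq ks -subn_eq0 e.
  by rewrite fs big_ord0.
have k1s : (k < s)%N by rewrite -subn_gt0 e.
have e1 : (s - k.+1)%N = d by rewrite subnS e.
pose T u := \sum_(j < d.+1) f (k + j)%N 0 * (u ^+ j / j`!%:R).
have dT : has_deriv T (f k.+1).
  have TE : T = (fun u => f k 0 + \sum_(j < d) f (k.+1 + j)%N 0 * (u ^+ j.+1 / j.+1`!%:R)).
    apply/funext => u; rewrite /T big_ord_recl addn0 expr0 fact0 divr1 mulr1.
    by under eq_bigr do rewrite lift0 addnS -addSn.
  rewrite TE; apply: (eq_has_deriv (dg := f k.+1) (has_derivD (has_deriv_cst _)
    (@has_deriv_sum _ _ _ (fun (j : 'I_d) u => f (k.+1 + j)%N 0 * (u ^+ j / j`!%:R)) _))).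
    by move=> i; apply: has_derivZ; exact: has_deriv_taylor_monomial.
  by move=> u; rewrite add0r (IH k.+1 u).
(* [f k] and its Taylor polynomial have the same derivative, hence differ by a
   constant, which vanishes because they agree at 0. *)
have := has_deriv0_cst (eq_has_deriv (has_derivB (fd _ k1s) dT) (fun u => subrr _)) t.
rewrite {2}/T big_ord_recl addn0 expr0 fact0 divr1 mulr1.
rewrite big1 ?addr0 ?subrr => [/eqP|i _]; first by rewrite subr_eq0 => /eqP.
by rewrite lift0 expr0n mul0r mulr0.
Qed.

End Derivatives.

(** * The matrix exponential solves X' = M X *)

Section MatrixExponential.
Variables (R : realType) (n : nat).
Implicit Types (M : 'M[R]_n) (t : R).

(** Entrywise geometric growth of the powers: it compares every entry of the
    exponential series with a scalar exponential series. *)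
Lemma mxpow_entry_bound M k i j :
  `|(M ^+ k) i j| <= (1 + \sum_i \sum_j `|M i j|) ^+ k.
Proof.
set N := \sum_i _; have N0 : 0 <= N by do 2 apply: sumr_ge0 => ? _.
elim: k i j => [|k IH] i j.
  by rewrite !expr0 mxE; case: (i == j); rewrite ?normr1 ?normr0.
rewrite exprS mxE (le_trans (ler_norm_sum _ _ _))// exprS.
apply: (@le_trans _ _ (\sum_l `|M i l| * (1 + N) ^+ k)).
  by apply: ler_sum => l _; rewrite normrM ler_wpM2l.
rewrite -mulr_suml ler_wpM2r ?exprn_ge0 ?addr_ge0//.
rewrite ler_wpDl// /N [leRHS](bigD1 i)//= lerDl.
by do 2 apply: sumr_ge0 => ? _.
Qed.

Lemma exprmxZ t M k : (t *: M) ^+ k = t ^+ k *: M ^+ k.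
Proof.
elim: k => [|k IH]; first by rewrite !expr0 scale1r.
rewrite !exprS IH -[LHS]/((t *: M) *m (t ^+ k *: M ^+ k)).
by rewrite -scalemxAl -scalemxAr scalerA.
Qed.

Definition expmx_coef M (i j : 'I_n) k : R := (M ^+ k) i j / k`!%:R.

(** The derived power series is [M] applied to the original one: this is
    X' = M X at the level of coefficients. *)
Lemma expmx_coef_diffs M i j :
  pseries_diffs (expmx_coef M i j) = fun k => \sum_l M i l * expmx_coef M l j k.
Proof.
apply/funext => k; rewrite /pseries_diffs /expmx_coef exprS mxE.
have k1 : k.+1%:R != 0 :> R by rewrite pnatr_eq0.
rewrite mulrCA factS natrM invfM mulVKf// mulr_suml.
by apply: eq_bigr => l _; rewrite mulrA.
Qed.

Lemma is_cvg_expmx_pseries M i j t : cvgn (pseries (expmx_coef M i j) t).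
Proof.
apply: normed_cvg; set N := 1 + \sum_i \sum_j `|M i j|.
have N0 : 0 <= N by rewrite addr_ge0//; do 2 apply: sumr_ge0 => ? _.
apply: (series_le_cvg (v_ := exp_coeff (N * `|t|))) => [k|k|k|].
- by rewrite /= normr_ge0.
- by rewrite exp_coeff_ge0// mulr_ge0.
- rewrite /= /expmx_coef /exp_coeff /= !normrM normfV normr_nat normrX exprMn.
  rewrite mulrAC ler_wpM2r ?invr_ge0// ler_wpM2r ?exprn_ge0//.
  exact: mxpow_entry_bound.
- exact: is_cvg_series_exp_coeff.
Qed.

Lemma expmx_entry M t i j :
  expmx (t *: M) i j = limn (pseries (expmx_coef M i j) t).
Proof.
pose E := \matrix_(i, j) limn (pseries (expmx_coef M i j) t) : 'M[R]_n.
suff -> : expmx (t *: M) = E by rewrite mxE.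
apply: cvg_lim => //; apply/cvg_ballP => e e0.
have H i' j' : \forall k \near \oo,
    ball (E i' j') e (pseries (expmx_coef M i' j') t k).
  rewrite mxE.
  have /cvg_ballP H : pseries (expmx_coef M i' j') t @ \oo --> limn (pseries (expmx_coef M i' j') t).
    exact: is_cvg_expmx_pseries.
  exact: H.
have : \forall k \near \oo, forall i' j',
    ball (E i' j') e (pseries (expmx_coef M i' j') t k).
  by apply: filter_forall => i'; apply: filter_forall => j'; exact: H.
apply: filterS => k Hk; split=> // i' j'.
suff -> : series (fun k => k`!%:R^-1 *: (t *: M) ^+ k) k i' j' =
   pseries (expmx_coef M i' j') t k by exact: Hk.
rewrite /pseries /series/= summxE; apply: eq_bigr => l _.
by rewrite mxE exprmxZ mxE /expmx_coef mulrCA mulrC (mulrC _^-1).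
Qed.

Lemma has_deriv_expmx M i j :
  has_deriv (fun t => expmx (t *: M) i j)
            (fun t => (M *m expmx (t *: M)) i j).
Proof.
move=> t.
rewrite (_ : (fun _ => _) = (fun t => limn (pseries (expmx_coef M i j) t))); last first.
  by apply/funext => u; rewrite expmx_entry.
have diffs_cvg (f : 'I_n -> R) x :
    series (fun k => (\sum_l f l * expmx_coef M l j k) * x ^+ k) @ \oo
      --> \sum_l f l * limn (pseries (expmx_coef M l j) x).
  rewrite (_ : series _ = (fun k => \sum_l f l * pseries (expmx_coef M l j) x k)).
    apply: cvg_big => [|l _]; first exact: add_continuous.
    apply: cvgMl_tmp; exact: is_cvg_expmx_pseries.
  apply/funext => k; rewrite /pseries /series/=.
  under [RHS]eq_bigr do rewrite mulr_sumr.
  rewrite exchange_big; apply: eq_bigr => l _.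
  by rewrite mulr_suml; apply: eq_bigr => i' _; rewrite mulrA.
rewrite (_ : (M *m _) i j = limn (pseries (pseries_diffs (expmx_coef M i j)) t)).
  apply: (@pseries_snd_diffs _ _ (`|t| + 1)).
  - exact: is_cvg_expmx_pseries.
  - rewrite expmx_coef_diffs; apply/cvg_ex; eexists; exact: diffs_cvg.
  - have -> : pseries_diffs (pseries_diffs (expmx_coef M i j)) =
        fun k => \sum_l (M ^+ 2) i l * expmx_coef M l j k.
      rewrite expmx_coef_diffs; apply/funext => k; rewrite /pseries_diffs mulr_sumr.
      under eq_bigr => l _.
        rewrite mulrCA (_ : _ * expmx_coef _ _ _ _ = pseries_diffs (expmx_coef M l j) k)//.
        rewrite expmx_coef_diffs mulr_sumr. over.
      rewrite exchange_big; apply: eq_bigr => l _.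
      by rewrite expr2 mxE mulr_suml; apply: eq_bigr => l' _; rewrite mulrA.
    apply/cvg_ex; eexists; exact: diffs_cvg.
  - by rewrite [ltRHS]ger0_norm ?addr_ge0// ltrDl.
rewrite expmx_coef_diffs mxE; apply/esym/cvg_lim => //.
by under eq_bigr do rewrite expmx_entry; exact: diffs_cvg.
Qed.

Lemma expmx_at0 M : expmx (0 *: M) = 1%:M.
Proof.
apply/matrixP => i j; rewrite expmx_entry; apply: (@lim_near_cst R^o) => //.
exists 1%N => // k /= k0.
rewrite /pseries /series/= big_ltn// big_nat_cond big1 => [|l /andP[/andP[l0 _] _]].
  by rewrite addr0 /expmx_coef !expr0 fact0 divr1 mulr1.
by rewrite expr0n gtn_eqF// mulr0.
Qed.

End MatrixExponential.

(** * The operator norm and the entries *)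

Section OperatorNorm.
Variables (R : realType).

Lemma enorm_le_sum n (x : 'cV[R]_n) : enorm x <= \sum_i `|x i 0|.
Proof.
rewrite /enorm -[leRHS]ger0_norm ?sumr_ge0// -sqrtr_sqr ler_wsqrtr//.
have [//] : \sum_i x i 0 ^+ 2 <= (\sum_i `|x i 0|) ^+ 2 /\ 0 <= \sum_i `|x i 0|.
elim/big_ind2 : _ => [|y z y' z' [yz z0] [yz' z0']|i _].
- by rewrite expr0n.
- by split; [nra|rewrite addr_ge0].
- by rewrite real_normK ?num_real.
Qed.

Lemma entry_le_enorm n (x : 'cV[R]_n) i : `|x i 0| <= enorm x.
Proof.
rewrite -sqrtr_sqr /enorm ler_wsqrtr// (bigD1 i)//= lerDl.
by rewrite sumr_ge0// => j _; exact: sqr_ge0.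
Qed.

Lemma enorm_mul_le m n (M : 'M[R]_(m, n)) (x : 'cV[R]_n) :
  enorm x <= 1 -> enorm (M *m x) <= \sum_i \sum_j `|M i j|.
Proof.
move=> x1; apply: (le_trans (enorm_le_sum _)); apply: ler_sum => i _.
rewrite mxE (le_trans (ler_norm_sum _ _ _))//; apply: ler_sum => j _.
by rewrite normrM ler_piMr// (le_trans (entry_le_enorm _ _)).
Qed.

Lemma opnorm_le_sum m n (M : 'M[R]_(m, n)) : opnorm M <= \sum_i \sum_j `|M i j|.
Proof.
apply: ge_sup => [|_ [x x1 <-]]; last exact: enorm_mul_le.
exists (enorm (M *m 0)), 0 => //=; rewrite /enorm big1 ?sqrtr0// => i _.
by rewrite mxE expr0n.
Qed.

Lemma entry_le_opnorm m n (M : 'M[R]_(m, n)) i j : `|M i j| <= opnorm M.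
Proof.
pose e : 'cV[R]_n := \col_k (k == j)%:R.
have e1 : enorm e <= 1.
  rewrite /enorm (bigD1 j)//= big1 => [|k kj]; last by rewrite mxE (negbTE kj) expr0n.
  by rewrite mxE eqxx expr1n addr0 sqrtr1.
have <- : (M *m e) i 0 = M i j.
  rewrite mxE (bigD1 j)//= big1 => [|k kj]; last by rewrite mxE (negbTE kj) mulr0.
  by rewrite mxE eqxx mulr1 addr0.
apply: (le_trans (entry_le_enorm _ _)); apply: ub_le_sup; last by exists e.
by exists (\sum_i \sum_j `|M i j|) => _ [x x1 <-]; exact: enorm_mul_le.
Qed.

End OperatorNorm.

(** * The resolvent and the Krylov space *)

Section Resolvent.
Variables (F : fieldType).

(** The two sides agree at the [N] nodes and have degree less than [N]. *)
Lemma lagrange_interpolation N (mu : 'I_N -> F) (f : {poly F}) :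
  injective mu -> (size f <= N)%N ->
  f = \sum_i (f.[mu i] / \prod_(j | j != i) (mu i - mu j)) *:
        \prod_(j | j != i) ('X - (mu j)%:P).
Proof.
move=> mu_inj fN; apply/eqP; rewrite -subr_eq0; apply/eqP.
set g := \sum_i _.
have gN : (size g <= N)%N.
  apply: (leq_trans (size_sum _ _ _)); apply/bigmax_leqP => i _.
  apply: (leq_trans (size_scale_leq _ _)).
  rewrite -big_filter size_prod_XsubC size_filter -sum1_count sum1_card.
  by rewrite (cardC1 i) card_ord ltn_predL (leq_ltn_trans (leq0n i)).

apply: (@roots_geq_poly_eq0 _ _ [seq mu i | i <- enum 'I_N]).
- apply/allP => _ /mapP[i _ ->]; rewrite rootE hornerD hornerN horner_sum.
  rewrite (bigD1 i)//= [\sum_(_ < _ | _) _]big1 => [|j ji].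
    rewrite addr0 hornerZ horner_prod.
    under [X in _ / _ * X]eq_bigr do rewrite hornerXsubC.
    rewrite divfK ?subrr//; apply/prodf_neq0 => j ji.
    by rewrite subr_eq0; apply: contra ji => /eqP/mu_inj ->.
  rewrite hornerZ horner_prod [X in _ * X](bigD1 i) 1?eq_sym//= hornerXsubC subrr.
  by rewrite mul0r mulr0.
- by rewrite map_inj_uniq ?enum_uniq.
- by rewrite size_map size_enum_ord (leq_trans (size_polyD _ _))// size_polyN geq_max fN.
Qed.

Variables (n m : nat) (A : 'M[F]_n.+1) (B : 'M[F]_(n.+1, m)).

Lemma horner_mx_modp_char f : horner_mx A (f %% char_poly A) = horner_mx A f.
Proof.
by rewrite [in RHS](divp_eq f (char_poly A)) rmorphD rmorphM /= Cayley_Hamilton mulr0 add0r.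
Qed.

Lemma size_modp_char f : (size (f %% char_poly A)%R <= n.+1)%N.
Proof.
by rewrite -ltnS -(size_char_poly A) ltn_modp -size_poly_gt0 size_char_poly.
Qed.

(** By Cayley-Hamilton, every polynomial in [A] is a combination of the powers
    of [A] up to [n]. *)
Lemma krylov_kernel p (w : 'M[F]_(p, n.+1)) :
  (forall k, (k <= n)%N -> w *m A ^+ k *m B = 0) ->
  forall f, w *m horner_mx A f *m B = 0.
Proof.
move=> wAB f; rewrite -horner_mx_modp_char; have := size_modp_char f.
set g := (_ %% _) => gn; rewrite -[g]coefK poly_def rmorph_sum /= mulmx_sumr mulmx_suml.
apply: big1 => i _; rewrite linearZ/= rmorphXn/= horner_mx_X.
rewrite -scalemxAr -scalemxAl wAB ?scaler0//.
by rewrite -ltnS (leq_trans (ltn_ord i)).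
Qed.

(** A row annihilating (A - mu_i)^-1 B at n + 1 distinct points annihilates the
    Krylov space of (A, B). With P the product of the X - mu_i and P_i that
    product without its i-th factor, (A - mu_i)^-1 = P(A)^-1 P_i(A). By Lagrange
    interpolation the P_i span the polynomials of degree at most n, so that
    w P(A)^-1 g(A) B = 0 for all such g, and the choice of g as the remainder
    of P X^k modulo the characteristic polynomial gives w A^k B = 0. *)
Lemma resolvent_kernel p (w : 'M[F]_(p, n.+1)) (mu : 'I_n.+1 -> F) :
  injective mu -> (forall i, A - (mu i)%:M \in unitmx) ->
  (forall i, w *m invmx (A - (mu i)%:M) *m B = 0) ->
  forall k, w *m A ^+ k *m B = 0.
Proof.
move=> mu_inj Au wB k.
pose P := \prod_i ('X - (mu i)%:P); pose Pi i := \prod_(j | j != i) ('X - (mu j)%:P).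
have hX i : horner_mx A ('X - (mu i)%:P) = A - (mu i)%:M.
  by rewrite rmorphB /= horner_mx_X horner_mx_C.
have PE i : horner_mx A P = horner_mx A (Pi i) *m (A - (mu i)%:M).
  by rewrite /P (bigD1 i)//= mulrC rmorphM /= hX.
have Pu : horner_mx A P \in unitmx.
  rewrite /P; elim/big_rec: _ => [|i x _ IH]; first by rewrite rmorph1 unitmx1.
  by rewrite rmorphM/= hX unitmx_mul Au.
have inv i : invmx (horner_mx A P) *m horner_mx A (Pi i) = invmx (A - (mu i)%:M).
  rewrite -[RHS]mul1mx; apply: (canRL (mulmxK (Au i))); rewrite -mulmxA -PE; exact: mulVmx.
pose w' := w *m invmx (horner_mx A P).
have w'0 (g : {poly F}) : (size g <= n.+1)%N -> w' *m horner_mx A g *m B = 0.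
  move=> gn; rewrite (lagrange_interpolation mu_inj gn) rmorph_sum /=.
  rewrite mulmx_sumr mulmx_suml big1// => i _.
  by rewrite linearZ/= -scalemxAr -scalemxAl /w' -[w *m _ *m _]mulmxA inv wB scaler0.
have := w'0 _ (size_modp_char (P * 'X^k)).
by rewrite horner_mx_modp_char rmorphM rmorphXn /= horner_mx_X mulmxA /w' mulmxKV.
Qed.

End Resolvent.

(** * Assigning real eigenvalues on the reachable subspace *)

Section EigenvalueAssignment.
Variables (R : realType) (n m nu : nat).
Variables (A : 'M[R]_n.+1) (B : 'M[R]_(n.+1, m)) (Qu : 'M[R]_(n.+1, nu)) (Au : 'M[R]_nu).

Lemma subr_scalar_unitmx (F : fieldType) k (M : 'M[F]_k) (a : F) :
  ~~ root (char_poly M) a -> M - a%:M \in unitmx.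
Proof.
by rewrite -eigenvalue_root_char negbK kermx_eq0 row_free_unit.
Qed.

Lemma far_resolvent_points a : exists mu : 'I_n.+1 -> R,
  [/\ injective mu, (forall i, mu i <= a) & forall i, A - (mu i)%:M \in unitmx].
Proof.
pose c := Num.max (cauchy_bound (char_poly A)) (- a).
exists (fun i => - (c + i%:R)); split.
- move=> i j /oppr_inj /addrI /eqP; rewrite eqr_nat => /eqP; exact: val_inj.
- move=> i; rewrite lerNl (@le_trans _ _ c)// ?lerDl ?ler0n//.
  by rewrite /c le_max lexx orbT.
- move=> i; apply: subr_scalar_unitmx.
  apply: (le_cauchy_bound (monic_neq0 (char_poly_monic A))).
  rewrite in_itv/= lerN2 (@le_trans _ _ c)// ?lerDl ?ler0n//.
  by rewrite /c le_max lexx.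
Qed.

(** If v = (A - mu)^-1 B u, then A v = mu v + B u: any K with K v = - u makes
    v an eigenvector of A + BK for the eigenvalue mu. Such vectors v span the
    reachable subspace once mu takes n + 1 values (n + 1 being the dimension of
    the state), so a basis [V] of that subspace can be made of them; its
    independence allows prescribing [K] on it. The last conclusion says that
    the range of [V] contains that of the projection onto the reachable
    subspace along its orthogonal complement. *)
Lemma assign_reachable_eigenvalues (a : R) :
  Qu^T *m Qu = 1%:M -> Qu^T *m A = Au *m Qu^T -> Qu^T *m B = 0 ->
  (forall p (w : 'M[R]_(p, n.+1)), (forall k, w *m A ^+ k *m B = 0) -> (w <= Qu^T)%MS) ->
  exists (K : 'M[R]_(m, n.+1)) r (V : 'M[R]_(n.+1, r)) (V' : 'M[R]_(r, n.+1)) (d : 'rV[R]_r),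
  [/\ forall i, d 0 i <= a, (A + B *m K) *m V = V *m diag_mx d, V' *m V = 1%:M,
      Qu^T *m V = 0 & V *m V' *m (1%:M - Qu *m Qu^T) = 1%:M - Qu *m Qu^T].
Proof.
move=> QQ QA QB Qker; have [mu [mu_inj mua muU]] := far_resolvent_points a.
pose J : finType := ('I_n.+1 * 'I_m)%type.
pose Rv i := invmx (A - (mu i)%:M).
pose G : 'M[R]_(n.+1, #|J|) := \matrix_(x, k) (Rv (enum_val k).1 *m B) x (enum_val k).2.
pose r := \rank G^T; pose f := maxrankfun G^T.
pose e k : J := enum_val (f k).
pose V : 'M[R]_(n.+1, r) := \matrix_(x, k) (Rv (e k).1 *m B) x (e k).2.
have VG : V^T = rowsub f G^T by apply/matrixP => x k; rewrite !mxE.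
have /row_freeP[Z VZ] : row_free V^T by rewrite VG maxrowsub_free.
pose U : 'M[R]_(m, r) := \matrix_(y, k) (y == (e k).2)%:R.
pose d : 'rV[R]_r := \row_k mu (e k).1.
have V'V : Z^T *m V = 1%:M by rewrite -[V]trmxK -trmx_mul VZ trmx1.
have AR i : A *m Rv i = mu i *: Rv i + 1%:M.
  have := mulmxV (muU i); rewrite mulmxBl mul_scalar_mx => /eqP.
  by rewrite subr_eq [1%:M + _]addrC => /eqP.
have AV : A *m V = V *m diag_mx d + B *m U.
  apply/matrixP => x k; rewrite [RHS]mxE mul_mx_diag.
  have -> : (A *m V) x k = (A *m Rv (e k).1 *m B) x (e k).2.
    by rewrite -mulmxA !mxE; apply: eq_bigr => l _; rewrite !mxE.
  rewrite AR mulmxDl mul1mx -scalemxAl mxE [X in X + _]mxE [(\matrix_(_, _) _) _ _]mxE.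
  rewrite [V _ _]mxE [d _ _]mxE mulrC; congr (_ + _).
  rewrite mxE (bigD1 (e k).2)//= mxE eqxx mulr1 big1 ?addr0// => j jk.
  by rewrite mxE (negbTE jk) mulr0.
(* (Au - mu) Qu^T (A - mu)^-1 B = Qu^T B = 0, and Au - mu is invertible. *)
have QR i : Qu^T *m Rv i *m B = 0.
  have E : Qu^T *m (A - (mu i)%:M) = (Au - (mu i)%:M) *m Qu^T.
    by rewrite mulmxBr mulmxBl QA mul_mx_scalar mul_scalar_mx.
  have E1 : (Au - (mu i)%:M) *m (Qu^T *m Rv i) = Qu^T.
    by rewrite mulmxA -E mulmxK ?muU.
  have E2 : (Au - (mu i)%:M) *m (Qu^T *m Rv i *m Qu) = 1%:M by rewrite mulmxA E1.
  have [E3 _] := mulmx1_unit E2.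
  by rewrite -[LHS](mulKmx E3) [(_ - _) *m (_ *m B)]mulmxA E1 QB mulmx0.
exists (- (U *m Z^T)), r, V, Z^T, d; split => //.
- by move=> i; rewrite mxE.
- by rewrite mulmxDl AV mulmxN mulNmx -!mulmxA V'V mulmx1 addrK.
- apply/matrixP => x k; have /matrixP/(_ x (e k).2) := QR (e k).1.
  rewrite -mulmxA [RHS]mxE [LHS]mxE => E; rewrite [RHS]mxE -[RHS]E mxE.
  apply: eq_bigr => l _.
  by rewrite [V l k]mxE.
- set H := 1%:M - _.
  (* By duality: a row killed by all the vectors (A - mu_i)^-1 B u lies in the
     row space of Qu^T, hence is killed by H. *)
  have HV : (H^T <= V^T)%MS.
    rewrite VG eq_maxrowsub submxE; apply/eqP; apply: trmx_inj.
    rewrite trmx_mul trmxK trmx0; set w := (cokermx _)^T.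
    have wG : w *m G = 0 by rewrite -[G]trmxK -trmx_mul mulmx_coker trmx0.
    have /submxP[Y ->] : (w <= Qu^T)%MS.
      apply: Qker; apply: (resolvent_kernel mu_inj muU) => i.
      apply/matrixP => x y.
      have /matrixP/(_ x (enum_rank (i, y))) := wG.
      rewrite -mulmxA [RHS]mxE [LHS]mxE => E; rewrite [RHS]mxE -[RHS]E mxE.
  apply: eq_bigr => l _.
      by rewrite [G l _]mxE enum_rankK.
    by rewrite -mulmxA mulmxBr mulmx1 mulmxA QQ mul1mx subrr mulmx0.
  case/submxP: HV => Y HY; have -> : H = V *m Y^T by rewrite -[V]trmxK -trmx_mul -HY trmxK.
  by rewrite -!mulmxA [_ *m (V *m _)]mulmxA V'V mul1mx.
Qed.

End EigenvalueAssignment.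

(** * Complex modes of the matrix exponential *)

Section ComplexModes.
Variable R : realType.
Local Notation toC := (real_complex R).
Local Notation normc := Normc.normc.
Implicit Types (z w : R[i]).

Lemma ReD z w : complex.Re (z + w) = complex.Re z + complex.Re w.
Proof. by case: z w => [? ?] [? ?]. Qed.

Lemma ImD z w : complex.Im (z + w) = complex.Im z + complex.Im w.
Proof. by case: z w => [? ?] [? ?]. Qed.

Lemma ReM z w : complex.Re (z * w) = complex.Re z * complex.Re w - complex.Im z * complex.Im w.
Proof. by case: z w => [? ?] [? ?]. Qed.

Lemma ImM z w : complex.Im (z * w) = complex.Re z * complex.Im w + complex.Im z * complex.Re w.
Proof. by case: z w => [? ?] [? ?]. Qed.

Lemma ReZ (x : R) z : complex.Re (x%:C * z) = x * complex.Re z.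
Proof. by rewrite ReM mul0r subr0. Qed.

Lemma ImZ (x : R) z : complex.Im (x%:C * z) = x * complex.Im z.
Proof. by rewrite ImM mul0r addr0. Qed.

Lemma eqC z w : complex.Re z = complex.Re w -> complex.Im z = complex.Im w -> z = w.
Proof. by case: z w => [? ?] [? ?] /= -> ->. Qed.

Lemma normc_real (x : R) : normc x%:C = `|x|.
Proof. by rewrite /Normc.normc /= expr0n addr0 sqrtr_sqr. Qed.

Lemma normc_ge0 z : 0 <= normc z.
Proof. by case: z => a b; exact: sqrtr_ge0. Qed.

Lemma normc_sum I (r : seq I) (P : pred I) (F : I -> R[i]) :
  normc (\sum_(i <- r | P i) F i) <= \sum_(i <- r | P i) normc (F i).
Proof.
elim/big_rec2: _ => [|i y z _ IH]; first by rewrite Normc.normc0.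
by rewrite (le_trans (le_normcD _ _))// lerD2l.
Qed.

(** Differentiability of a complex function of a real variable, read on its
    real and imaginary parts. *)
Definition has_derivC (f df : R -> R[i]) :=
  has_deriv (fun t => complex.Re (f t)) (fun t => complex.Re (df t)) /\
  has_deriv (fun t => complex.Im (f t)) (fun t => complex.Im (df t)).

Lemma has_derivC_ext f g df dg : has_derivC f df ->
  (forall t, f t = g t) -> (forall t, df t = dg t) -> has_derivC g dg.
Proof. by move=> fd /funext <- /funext <-. Qed.

Lemma has_derivC_sum I (r : seq I) (F dF : I -> R -> R[i]) :
  (forall i, has_derivC (F i) (dF i)) ->
  has_derivC (fun t => \sum_(i <- r) F i t) (fun t => \sum_(i <- r) dF i t).
Proof.
move=> FdF; split.
  rewrite (_ : (fun _ => _) = (fun t => \sum_(i <- r) complex.Re (F i t))).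
    apply: (eq_has_deriv (has_deriv_sum r (fun i => (FdF i).1))) => t.
    by rewrite (big_morph _ ReD (erefl _)).
  by apply/funext => t; rewrite (big_morph _ ReD (erefl _)).
rewrite (_ : (fun _ => _) = (fun t => \sum_(i <- r) complex.Im (F i t))).
  apply: (eq_has_deriv (has_deriv_sum r (fun i => (FdF i).2))) => t.
  by rewrite (big_morph _ ImD (erefl _)).
by apply/funext => t; rewrite (big_morph _ ImD (erefl _)).
Qed.

Lemma has_derivC_scale z (f df : R -> R) : has_deriv f df ->
  has_derivC (fun t => (f t)%:C * z) (fun t => (df t)%:C * z).
Proof.
move=> fd; split.
  rewrite (_ : (fun _ => _) = (fun t => complex.Re z * f t)).
    by apply: (eq_has_deriv (has_derivZ _ fd)) => t; rewrite ReZ mulrC.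
  by apply/funext => t; rewrite ReZ mulrC.
rewrite (_ : (fun _ => _) = (fun t => complex.Im z * f t)).
  by apply: (eq_has_deriv (has_derivZ _ fd)) => t; rewrite ImZ mulrC.
by apply/funext => t; rewrite ImZ mulrC.
Qed.

Lemma has_derivCM f df g dg : has_derivC f df -> has_derivC g dg ->
  has_derivC (fun t => f t * g t) (fun t => df t * g t + f t * dg t).
Proof.
move=> [f1 f2] [g1 g2]; split.
  rewrite (_ : (fun _ => _) = (fun t => complex.Re (f t) * complex.Re (g t)
     - complex.Im (f t) * complex.Im (g t))); last by apply/funext => t; rewrite ReM.
  apply: (eq_has_deriv (has_derivB (has_derivM f1 g1) (has_derivM f2 g2))) => t.
  by rewrite ReD !ReM; ring.
rewrite (_ : (fun _ => _) = (fun t => complex.Re (f t) * complex.Im (g t)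
   + complex.Im (f t) * complex.Re (g t))); last by apply/funext => t; rewrite ImM.
apply: (eq_has_deriv (has_derivD (has_derivM f1 g2) (has_derivM f2 g1))) => t.
by rewrite ImD !ImM; ring.
Qed.

Definition cis (b : R) : R[i] := cos b +i* sin b.

(** exp (l t). *)
Definition expC (l : R[i]) (t : R) : R[i] :=
  (expR (complex.Re l * t))%:C * cis (complex.Im l * t).

Lemma has_derivC_expC l : has_derivC (expC l) (fun t => l * expC l t).
Proof.
have c : has_derivC (fun t => cis (complex.Im l * t))
    (fun t => (0 +i* complex.Im l) * cis (complex.Im l * t)).
  split.
    apply: (eq_has_deriv (has_deriv_cos (complex.Im l))) => t.
    by rewrite ReM /=; ring.
  apply: (eq_has_deriv (has_deriv_sin (complex.Im l))) => t.
  by rewrite ImM /=; ring.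
have e := has_derivC_scale 1 (has_deriv_expR (complex.Re l)).
apply: (has_derivC_ext (has_derivCM e c)) => t.
  by rewrite mulr1.
rewrite /expC; set E := expR _; set C := cis _.
rewrite !mulr1 [X in _ = X * _]complexE rmorphM/=.
have -> : 0 +i* complex.Im l = 'i%C * (complex.Im l)%:C.
  by apply: eqC; rewrite ?ReM ?ImM /=; ring.
by ring.
Qed.

Lemma normc_expC l t : normc (expC l t) = expR (complex.Re l * t).
Proof.
rewrite Normc.normcM normc_real ger0_norm ?expR_ge0//.
by rewrite /Normc.normc /= cos2Dsin2 sqrtr1 mulr1.
Qed.

Lemma expC_mulN l t : expC l t * expC (- l) t = 1.
Proof.
rewrite /expC mulrACA -rmorphM -expRD.
have -> : complex.Re l * t + complex.Re (- l) * t = 0 by case: l => a b /=; ring.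
have -> : complex.Im (- l) * t = - (complex.Im l * t) by case: l => a b /=; ring.
rewrite expR0 mul1r; set b := complex.Im l * t.
by apply: eqC; rewrite ?ReM ?ImM /= cosN sinN; [rewrite -(cos2Dsin2 b)|]; ring.
Qed.

Lemma expC0 l : expC l 0 = 1.
Proof. by rewrite /expC /cis !mulr0 expR0 cos0 sin0 mul1r. Qed.

(** Multiplying the functions by exp (- l t) turns the system
    phi_k' = l phi_k + phi_(k+1) into psi_k' = psi_(k+1), to which Taylor
    expansion applies. *)
Lemma jordan_chain_solution (l : R[i]) (s : nat) (phi : nat -> R -> R[i]) :
  (forall k, (k < s)%N -> has_derivC (phi k) (fun t => l * phi k t + phi k.+1 t)) ->
  (forall t, phi s t = 0) ->
  forall k t, (k <= s)%N ->
  phi k t = expC l t * \sum_(j < s - k) (t ^+ j / j`!%:R)%:C * phi (k + j)%N 0.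
Proof.
move=> phid phis k t ks.
pose psi k t := expC (- l) t * phi k t.
have psid k' : (k' < s)%N -> has_derivC (psi k') (psi k'.+1).
  move=> k's; apply: (has_derivC_ext (has_derivCM (has_derivC_expC (- l)) (phid _ k's))) => u //.
  by rewrite /psi; ring.
have psis u : psi s u = 0 by rewrite /psi phis mulr0.
have psi0 k' : psi k' 0 = phi k' 0 by rewrite /psi expC0 mul1r.
have -> : phi k t = expC l t * psi k t by rewrite /psi mulrA expC_mulN mul1r.
congr (_ * _); apply: eqC.
  rewrite (taylor_chain (f := fun k t => complex.Re (psi k t)) (s := s))//.
  - rewrite [RHS](big_morph _ ReD (erefl _)); apply: eq_bigr => j _.
    by rewrite psi0 ReZ mulrC.
  - by move=> k' k's; exact: (psid k' k's).1.
  - by move=> u; rewrite psis.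
rewrite (taylor_chain (f := fun k t => complex.Im (psi k t)) (s := s))//.
- rewrite [RHS](big_morph _ ImD (erefl _)); apply: eq_bigr => j _.
  by rewrite psi0 ImZ mulrC.
- by move=> k' k's; exact: (psid k' k's).2.
- by move=> u; rewrite psis.
Qed.

(** Bilinear forms of the exponential are linear in its entries. *)
Lemma has_derivC_bilinear n p (M : 'M[R]_n) (w : 'M[R[i]]_(p, n)) q (v : 'M[R[i]]_(n, q)) x y :
  has_derivC (fun t => (w *m map_mx toC (expmx (t *: M)) *m v) x y)
    (fun t => (w *m map_mx toC M *m map_mx toC (expmx (t *: M)) *m v) x y).
Proof.
have E (Y : 'M[R]_n) : (w *m map_mx toC Y *m v) x y =
    \sum_j \sum_i (Y i j)%:C * (w x i * v j y).
  rewrite mxE; apply: eq_bigr => j _; rewrite mxE mulr_suml; apply: eq_bigr => i _.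
  by rewrite mxE mulrAC mulrC mulrA.
apply: (has_derivC_ext (has_derivC_sum _ (fun j => has_derivC_sum _
   (fun i => has_derivC_scale (w x i * v j y) (has_deriv_expmx M i j))))) => t.
  by rewrite E.
by rewrite -[X in X *m v]mulmxA -map_mxM E.
Qed.

Lemma jordan_chain_expmx n (M : 'M[R]_n) (l : R[i]) (s : nat)
    (w : nat -> 'rV[R[i]]_n) q (v : 'M[R[i]]_(n, q)) y :
  (forall k, (k < s)%N -> w k *m map_mx toC M = l *: w k + w k.+1) -> w s = 0 ->
  forall k t, (k <= s)%N ->
  (w k *m map_mx toC (expmx (t *: M)) *m v) 0 y =
    expC l t * \sum_(j < s - k) (t ^+ j / j`!%:R)%:C * (w (k + j)%N *m v) 0 y.
Proof.
move=> wM ws k t ks.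
rewrite (jordan_chain_solution (l := l) (s := s)
  (phi := fun k t => (w k *m map_mx toC (expmx (t *: M)) *m v) 0 y))//.
- congr (_ * _); apply: eq_bigr => j _.
  by rewrite expmx_at0 map_mx1 mulmx1.
- move=> k' k's; apply: (has_derivC_ext (has_derivC_bilinear M (w k') v 0 y)) => u //.
  by rewrite wM// !mulmxDl -!scalemxAl !mxE.
- by move=> u; rewrite ws !mul0mx mxE.
Qed.

End ComplexModes.

(** * Jordan forms through their blocks *)

Section JordanChains.
Variable F : fieldType.

(** The slices of the two base changes along the blocks: [L i] gathers the left
    chain of block [i], [T i] the right one. *)
Lemma jordan_form_blocks n (M : 'M[F]_n) r (l : 'I_r -> F) (s : 'I_r -> nat) :
  is_jordan_form M l s ->
  exists (L : forall i, 'M[F]_(s i, n)) (T : forall i, 'M[F]_(n, s i)),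
  [/\ forall i, L i *m M = jordan_block (l i) (s i) *m L i,
      forall i, M *m T i = T i *m jordan_block (l i) (s i),
      forall i, L i *m T i = 1%:M & \sum_i T i *m L i = 1%:M].
Proof.
move=> [_ [P [P' [PP' P'P PMP]]]].
exists (fun i => submxcol P' i), (fun i => submxrow P i).
have PM : P' *m M = \mxdiag_i jordan_block (l i) (s i) *m P'.
  by rewrite -PMP -!mulmxA PP' mulmx1.
have MP : M *m P = P *m \mxdiag_i jordan_block (l i) (s i).
  by rewrite -PMP !mulmxA PP' mul1mx.
split=> [i|i|i|].
- rewrite submxcol_mul PM -[X in _ *m X](submxcolK P') mul_mxdiag_mxcol.
  by rewrite mxcolK.
- rewrite mul_submxrow MP -[X in X *m _](submxrowK P) mul_mxrow_mxdiag.
  by rewrite mxrowK.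
- rewrite mul_submxrow submxcol_mul P'P -submxblockEv.
  by rewrite -mxdiagZ submxblock_diag.
- by rewrite -mul_mxrow_mxcol submxcolK submxrowK.
Qed.

(** The rows of a block, continued by zero: row [k] is then mapped to [l] times
    itself plus row [k.+1] for every [k], the last one included. *)
Definition chain_row n s (L : 'M[F]_(s, n)) (k : nat) : 'rV[F]_n :=
  if insub k is Some i then row i L else 0.

Lemma chain_row_ord n s (L : 'M[F]_(s, n)) (k : 'I_s) : chain_row L k = row k L.
Proof. by rewrite /chain_row valK. Qed.

Lemma chain_row_out n s (L : 'M[F]_(s, n)) k : (s <= k)%N -> chain_row L k = 0.
Proof. by move=> sk; rewrite /chain_row insubN// -leqNgt. Qed.

Lemma jordan_block_chain n s (l : F) (L : 'M[F]_(s, n)) (k : 'I_s) :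
  row k (jordan_block l s *m L) = l *: chain_row L k + chain_row L k.+1.
Proof.
apply/rowP => y; rewrite chain_row_ord !mxE.
under eq_bigr do rewrite mxE mulrDl.
rewrite big_split /=; congr (_ + _).
  rewrite (bigD1 k)//= eqxx mulr1n big1 ?addr0// => j jk.
  by rewrite eq_sym (negbTE jk) mulr0n mul0r.
have [ks|sk] := ltnP k.+1 s; last first.
  rewrite chain_row_out// mxE big1// => j _.
  by rewrite (_ : (_ == _) = false) ?mul0r//; apply/eqP => jk; move: (ltn_ord j); rewrite jk ltnNge sk.
rewrite -[k.+1]/(val (Ordinal ks)) chain_row_ord mxE (bigD1 (Ordinal ks))//= eqxx mul1r.
rewrite big1 ?addr0// => j; rewrite -val_eqE /= => /negbTE ->.
by rewrite mul0r.
Qed.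

Lemma chain_row_mulmx n s (l : F) (L : 'M[F]_(s, n)) (M : 'M[F]_n) k :
  L *m M = jordan_block l s *m L -> (k < s)%N ->
  chain_row L k *m M = l *: chain_row L k + chain_row L k.+1.
Proof.
move=> LM ks; rewrite -(jordan_block_chain l L (Ordinal ks)) -LM row_mul.
by rewrite (chain_row_ord L (Ordinal ks)).
Qed.

(** Coordinate j of u J = a u reads (a - l) u_j = u_(j-1), with u_(-1) = 0; if
    a differs from l, all u_j vanish by induction. *)
Lemma jordan_block_eigenvalue s (l a : F) (u : 'rV[F]_s) :
  u *m jordan_block l s = a *: u -> u != 0 -> a = l.
Proof.
move=> uJ; apply: contraNeq => al; apply/eqP.
suff H k (j : 'I_s) : (j < k)%N -> u 0 j = 0 by apply/rowP => j; rewrite mxE (H s).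
elim: k j => // k IH j; rewrite ltnS => jk.
have /matrixP/(_ 0 j) := uJ; rewrite !mxE.
under eq_bigr do rewrite mxE mulrDr.
rewrite big_split /= (bigD1 j)//= eqxx mulr1n big1 => [|i ij]; last first.
  by rewrite (negbTE ij) mulr0n mulr0.
rewrite big1 => [|i _]; last first.
  have [ji|_] := eqVneq (nat_of_ord j) i.+1; last by rewrite mulr0.
  by rewrite (IH i) ?mul0r// -ji.
move=> /eqP; rewrite !addr0 mulrC -subr_eq0 -mulrBl mulf_eq0 subr_eq0.
by rewrite eq_sym (negbTE al) => /eqP.
Qed.

Lemma jordan_form_eigenvalue n (M : 'M[F]_n) r (l : 'I_r -> F) (s : 'I_r -> nat) a :
  is_jordan_form M l s -> eigenvalue M a <-> exists i, a = l i.
Proof.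
move=> J; have [s_gt0 _] := J; have [L [T [LM MT LT TL]]] := jordan_form_blocks J.
split=> [/eigenvalueP[v vM v0]|[i ->]].
  have [i vTi] : exists i, v *m T i != 0.
    apply/existsP; apply: contraNT v0 => /existsPn vT0.
    rewrite -[v]mulmx1 -TL mulmx_sumr big1// => i _.
    by have := vT0 i; rewrite negbK mulmxA => /eqP ->; rewrite mul0mx.
  exists i; apply: (@jordan_block_eigenvalue (s i) _ _ (v *m T i)) => //.
  by rewrite -mulmxA -MT mulmxA vM -scalemxAl.
(* The last row of a left chain is an eigenvector. *)
have [k ks] : exists k, s i = k.+1 by exists (s i).-1; rewrite prednK.
have ki : (k < s i)%N by rewrite ks.
apply/eigenvalueP; exists (chain_row (L i) k).
  rewrite (chain_row_mulmx (LM i) ki) [X in _ + X]chain_row_out ?addr0//.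
  by rewrite ks.
rewrite (chain_row_ord _ (Ordinal ki)); apply/eqP => L0.
have /matrixP/(_ (Ordinal ki) (Ordinal ki)) := LT i.
rewrite !mxE eqxx => /eqP; rewrite big1 1?eq_sym ?oner_eq0// => j _.
by have /rowP/(_ j) := L0; rewrite !mxE => ->; rewrite mul0r.
Qed.

End JordanChains.

Section SpectralAbscissa.
Variable R : realType.

Lemma jordan_spectral_abscissa n (M : 'M[R]_n.+1) r (l : 'I_r -> R[i]) (s : 'I_r -> nat) :
  is_jordan_form (map_mx (real_complex R) M) l s ->
  (exists i, complex.Re (l i) = spectral_abscissa M) /\
  (forall i, complex.Re (l i) <= spectral_abscissa M).
Proof.
move=> J; have [L [T [_ _ _ TL]]] := jordan_form_blocks J.
have [r0|r0] := posnP r.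
  exfalso; move: TL; rewrite big1 => [/matrixP/(_ 0 0)/eqP|i _].
    by rewrite !mxE eqxx eq_sym oner_eq0.
  by have := ltn_ord i; rewrite [X in (_ < X)%N]r0.
pose i0 := Ordinal r0.
have specE x : spectrum M x <-> exists i, x = l i by apply: (jordan_form_eigenvalue _ J).
pose i1 := [arg max_(i > i0) complex.Re (l i)]%O.
have i1P i : complex.Re (l i) <= complex.Re (l i1).
  by rewrite /i1; case: arg_maxP => // j _ H; exact: H.
have -> : spectral_abscissa M = complex.Re (l i1).
  apply/eqP; rewrite eq_le /spectral_abscissa; apply/andP; split.
    apply: ge_sup; first by exists (complex.Re (l i1)), (l i1) => //; apply/specE; exists i1.
    by move=> _ [x /specE[i ->] <-].
  apply: ub_le_sup; last by exists (l i1) => //; apply/specE; exists i1.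
  by exists (complex.Re (l i1)) => _ [x /specE[i ->] <-].
by split=> //; exists i1.
Qed.

End SpectralAbscissa.

(** * Growth comparison and scalar linear equations *)

Section Domination.
Variable R : realType.
Implicit Types (f g h : R -> R).

Definition dominated g f := exists2 C, 0 <= C & forall t, 0 <= t -> `|f t| <= C * g t.

Lemma dominated_le g f h : dominated g f ->
  (forall t, 0 <= t -> `|h t| <= `|f t|) -> dominated g h.
Proof. by move=> [C C0 fC] hf; exists C => // t t0; exact: le_trans (hf t t0) (fC t t0). Qed.

Lemma dominatedD g f h : dominated g f -> dominated g h ->
  dominated g (fun t => f t + h t).
Proof.
move=> [C C0 fC] [D D0 hD]; exists (C + D); first exact: addr_ge0.
by move=> t t0; rewrite mulrDl (le_trans (ler_normD _ _))// lerD ?fC ?hD.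
Qed.

Lemma dominatedZ g a f : dominated g f -> dominated g (fun t => a * f t).
Proof.
move=> [C C0 fC]; exists (`|a| * C); first exact: mulr_ge0.
by move=> t t0; rewrite normrM -mulrA ler_wpM2l ?fC.
Qed.

Lemma dominated_sum g (I : Type) (r : seq I) (F : I -> R -> R) :
  (forall t, 0 <= t -> 0 <= g t) -> (forall i, dominated g (F i)) ->
  dominated g (fun t => \sum_(i <- r) F i t).
Proof.
move=> g0 Fg; elim: r => [|i r [C C0 IH]].
  by exists 0 => // t t0; rewrite big_nil normr0 mul0r.
have [D D0 FD] := Fg i; exists (D + C); first exact: addr_ge0.
move=> t t0; rewrite big_cons mulrDl (le_trans (ler_normD _ _))// lerD ?FD ?IH//.
Qed.

Definition poly_exp (p : nat) (a t : R) := (1 + t) ^+ p * expR (a * t).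

Lemma poly_exp_gt0 p a t : 0 <= t -> 0 < poly_exp p a t.
Proof. by move=> t0; rewrite mulr_gt0 ?expR_gt0// exprn_gt0// ltr_pwDl. Qed.

Lemma poly_exp_ge0 p a t : 0 <= t -> 0 <= poly_exp p a t.
Proof. by move=> t0; rewrite ltW ?poly_exp_gt0. Qed.

(** From (1 + x)^p <= N^N exp x with N = p + 1, itself a power of
    1 + x <= N (1 + x / N) <= N exp (x / N), at x = eta t, and from
    eta (1 + t) <= 1 + eta t. The explicit power of [eta] is what the upper
    bound on the prefactor retains. *)
Lemma polynomial_le_exp p (eta t : R) : 0 < eta -> eta <= 1 -> 0 <= t ->
  (1 + t) ^+ p <= p.+1%:R ^+ p.+1 * eta ^- p * expR (eta * t).
Proof.
move=> e0 e1 t0; set N : R := p.+1%:R.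
have N1 : 1 <= N by rewrite ler1n.
have N0 : 0 < N by rewrite ltr0n.
have x0 : 0 <= eta * t by rewrite mulr_ge0// ltW.
have H : 1 + eta * t <= N * expR (eta * t / N).
  apply: (@le_trans _ _ (N * (1 + eta * t / N))); last by rewrite ler_wpM2l ?expR_ge1Dx// ltW.
  by rewrite mulrDr mulr1 mulrCA divff ?gt_eqF// mulr1 lerD2r.
have H1 : (1 + eta * t) ^+ p <= N ^+ p.+1 * expR (eta * t).
  apply: (@le_trans _ _ ((1 + eta * t) ^+ p.+1)); first by rewrite ler_weXn2l ?leqnSn ?lerDl.
  have -> : expR (eta * t) = expR (eta * t / N) ^+ p.+1.
    by rewrite -expRM_natl -/N mulrCA divff ?gt_eqF// mulr1.
  by rewrite -exprMn lerXn2r// nnegrE ?mulr_ge0 ?expR_ge0 ?addr_ge0// ltW.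
rewrite -mulrA [eta ^- p * _]mulrC mulrA ler_pdivlMr ?exprn_gt0//.
apply: le_trans H1; rewrite -exprMn.
have Ht : (1 + t) * eta <= 1 + eta * t by rewrite mulrDl mul1r [t * _]mulrC lerD2r.
by apply: lerXn2r => //; rewrite nnegrE ?mulr_ge0 ?addr_ge0 ?(ltW e0).
Qed.

Lemma poly_exp_dominated p p' (a b : R) : (a < b \/ a = b /\ (p' <= p)%N) ->
  dominated (poly_exp p b) (poly_exp p' a).
Proof.
case=> [ab|[-> pp]]; last first.
  exists 1 => // t t0; rewrite mul1r ger0_norm ?poly_exp_ge0// ler_wpM2r ?expR_ge0//.
  by rewrite ler_weXn2l// lerDl.
pose eta := Num.min (b - a) 1.
have e0 : 0 < eta by rewrite lt_min subr_gt0 ab ltr01.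
have e1 : eta <= 1 by rewrite ge_min lexx orbT.
have eab : eta <= b - a by rewrite ge_min lexx.
exists (p'.+1%:R ^+ p'.+1 * eta ^- p'); first by rewrite mulr_ge0 ?exprn_ge0// invr_ge0 exprn_ge0 ?ltW.
move=> t t0; rewrite ger0_norm ?poly_exp_ge0//.
apply: (@le_trans _ _ (p'.+1%:R ^+ p'.+1 * eta ^- p' * expR (eta * t) * expR (a * t))).
  by rewrite ler_wpM2r ?expR_ge0// polynomial_le_exp.
rewrite -mulrA ler_wpM2l ?mulr_ge0 ?exprn_ge0 ?invr_ge0 ?exprn_ge0 ?(ltW e0)//.
rewrite -expRD; apply: (@le_trans _ _ (expR (b * t))).
  by rewrite ler_expR -mulrDl ler_wpM2r// -lerBrDr.
by rewrite /poly_exp ler_peMl ?expR_ge0// exprn_ege1// lerDl.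
Qed.

Lemma has_deriv_shifted_power p : exists2 df : R -> R,
  has_deriv (fun t => (1 + t) ^+ p) df & forall t, 0 <= t -> 0 <= df t.
Proof.
elim: p => [|p [df fd df0]].
  exists (fun=> 0) => // t; rewrite (_ : (fun _ => _) = fun=> 1); first exact: has_deriv_cst.
  by apply/funext => u; rewrite expr0.
exists (fun t => (0 + 1) * (1 + t) ^+ p + (1 + t) * df t).
  move=> t; rewrite (_ : (fun _ => _) = fun u => (1 + u) * (1 + u) ^+ p).
    exact: (has_derivM (has_derivD (has_deriv_cst 1) (@has_deriv_id R)) fd t).
  by apply/funext => u; rewrite exprS.
move=> t t0; rewrite addr_ge0// mulr_ge0 ?exprn_ge0 ?addr_ge0// ?df0//.
Qed.

(** With phi = (1 + t)^p exp (a t) one has phi' >= a phi, hence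
    phi' - mu phi >= phi. So D phi - y is a supersolution of the homogeneous
    equation as soon as D phi >= g, and it stays nonnegative when D bounds the
    initial value. The same applies to - y. *)
Lemma linear_ode_dominated p (a mu : R) (y g : R -> R) : mu <= a - 1 ->
  has_deriv y (fun t => mu * y t + g t) ->
  dominated (poly_exp p a) g -> dominated (poly_exp p a) y.
Proof.
move=> mua; set phi := poly_exp p a.
have [dp pd dp0] := has_deriv_shifted_power p.
have bound (z h : R -> R) C D : has_deriv z (fun t => mu * z t + h t) ->
    (forall t, 0 <= t -> h t <= C * phi t) -> 0 <= C -> C <= D -> z 0 <= D ->
    forall t, 0 <= t -> z t <= D * phi t.
  move=> zd hC C0 CD zD t t0.
  have dphi := has_derivM pd (has_deriv_expR a).
  have d1 := has_derivM (has_deriv_expR (- mu)) (has_derivB (has_derivZ D dphi) zd).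

  have pos u : 0 <= u -> 0 <= - mu * expR (- mu * u) * (D * ((1 + u) ^+ p * expR (a * u)) - z u) +
     expR (- mu * u) * (D * (dp u * expR (a * u) + (1 + u) ^+ p * (a * expR (a * u))) -
      (mu * z u + h u)).
    move=> u0.
    (* The derivative of exp (- mu u) (D phi - z) is exp (- mu u) times a sum of
       nonnegative terms. *)
    have -> : forall E, - mu * E * (D * ((1 + u) ^+ p * expR (a * u)) - z u) +
       E * (D * (dp u * expR (a * u) + (1 + u) ^+ p * (a * expR (a * u))) - (mu * z u + h u))
      = E * (D * (dp u * expR (a * u)) + (D * (a - mu - 1) * phi u + (D - C) * phi u) + (C * phi u - h u)).
      by move=> E; rewrite /phi /poly_exp; ring.
    have D0 : 0 <= D := le_trans C0 CD.
    have amu : 0 <= a - mu - 1 by lra.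
    apply: mulr_ge0; first exact: expR_ge0.
    apply: addr_ge0; last by rewrite subr_ge0 hC.
    apply: addr_ge0; first by rewrite !mulr_ge0 ?expR_ge0 ?dp0.
    have DC : 0 <= D - C by rewrite subr_ge0.
    have phi0 : 0 <= phi u by exact: poly_exp_ge0.
    by apply: addr_ge0; apply: mulr_ge0 => //; apply: mulr_ge0.
  have H := has_deriv_ge0 d1 pos t0; move: H.
  rewrite !mulr0 expR0 addr0 expr1n !mulr1 mul1r => H.
  have H0 : 0 <= D - z 0 by rewrite subr_ge0.
  by have := le_trans H0 H; rewrite pmulr_rge0 ?expR_gt0// subr_ge0.
move=> yd [C C0 gC]; exists (`|y 0| + C); first exact: addr_ge0.
have CD : C <= `|y 0| + C by rewrite lerDr.
move=> t t0; rewrite ler_norml; apply/andP; split.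
  rewrite lerNl -[- y t]mulN1r; apply: (bound (fun t => (-1) * y t) (fun t => - g t) C) => //.
  - by apply: (eq_has_deriv (has_derivZ (-1) yd)) => u; ring.
  - by move=> u u0; rewrite (le_trans (ler_norm _))// normrN gC.
  - by rewrite mulN1r (le_trans (ler_norm _))// normrN lerDl.
apply: (bound y g C) => //.
  by move=> u u0; rewrite (le_trans (ler_norm _))// gC.
by rewrite (le_trans (ler_norm _))// lerDl.
Qed.

End Domination.

(** * The uncontrollable block in closed loop *)

Section KalmanFacts.
Variables (R : realType) (n m nc nu : nat).
Variables (A : 'M[R]_n.+1) (B : 'M[R]_(n.+1, m)) (Qc : 'M[R]_(n.+1, nc)) (Qu : 'M[R]_(n.+1, nu)).
Hypothesis kal : is_orthogonal_kalman A B Qc Qu.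

Lemma ctrb_kernelP p (w : 'M[R]_(p, n.+1)) :
  w *m ctrb_mx A B = 0 <-> forall k, w *m A ^+ k *m B = 0.
Proof.
rewrite /ctrb_mx mul_mxrow; split=> [/eqP|wAB]; last first.
  by rewrite -(@mxrow0 R _ (fun=> m) p); apply/eq_mxrowP => i; rewrite mulmxA wAB.
rewrite -(@mxrow0 R _ (fun=> m) p) => /eqP/eq_mxrowP wAB.
have wAB' k : (k <= n)%N -> w *m A ^+ k *m B = 0.
  by rewrite -ltnS => kn; have := wAB (Ordinal kn); rewrite /= mulmxA.
by move=> k; have := krylov_kernel wAB' 'X^k; rewrite rmorphXn /= horner_mx_X.
Qed.

Lemma kalman_orthonormal : Qu^T *m Qu = 1%:M.
Proof. by case: kal. Qed.

Lemma kalman_krylov k : Qu^T *m A ^+ k *m B = 0.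
Proof.
move: k; apply/ctrb_kernelP; apply/sub_kermxP.
by case: kal => _ _ _ /andP[].
Qed.

Lemma kalman_kernel p (w : 'M[R]_(p, n.+1)) :
  (forall k, w *m A ^+ k *m B = 0) -> (w <= Qu^T)%MS.
Proof.
move=> /ctrb_kernelP wC; apply: (@submx_trans _ _ _ _ _ _ (kermx (ctrb_mx A B))).
  exact/sub_kermxP.
by case: kal => _ _ _ /andP[].
Qed.

(** The left kernel of the controllability matrix, which is the row space of
    [Qu^T], is stable under right multiplication by [A]. *)
Lemma kalman_invariant : Qu^T *m A = uncontrollable_block A Qu *m Qu^T.
Proof.
have /submxP[Z QZ] : (Qu^T *m A <= Qu^T)%MS.
  by apply: kalman_kernel => k; rewrite -[Qu^T *m A *m _]mulmxA -[A *m _]exprS kalman_krylov.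
by rewrite /uncontrollable_block QZ -[Z *m _ *m Qu]mulmxA kalman_orthonormal mulmx1.
Qed.

Lemma kalman_input : Qu^T *m B = 0.
Proof. by have := kalman_krylov 0; rewrite expr0 mulmx1. Qed.

(** Feedback does not act on the uncontrollable block. *)
Lemma kalman_closed_loop (K : 'M[R]_(m, n.+1)) :
  Qu^T *m (A + B *m K) = uncontrollable_block A Qu *m Qu^T.
Proof. by rewrite mulmxDr kalman_invariant mulmxA kalman_input mul0mx addr0. Qed.

(** [nu] is the codimension of the range of the controllability matrix. *)
Lemma kalman_uncontrollable_dim : ~ controllable A B -> (0 < nu)%N.
Proof.
rewrite /controllable => nctrl; rewrite lt0n; apply/eqP => nu0.
have rQ : \rank Qu^T = nu.
  apply/eqP; rewrite -/(row_free _); apply/row_freeP; exists Qu.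
  exact: kalman_orthonormal.
have rK : \rank Qu^T = \rank (kermx (ctrb_mx A B)).
  by apply: eqmx_rank; case: kal.
apply: nctrl; apply/eqP; rewrite eqn_leq rank_leq_row -subn_eq0.
by rewrite -mxrank_ker -rK rQ nu0.
Qed.

End KalmanFacts.

Section Growth.
Variables (R : realType) (n m nc nu : nat).
Variables (A : 'M[R]_n.+1) (B : 'M[R]_(n.+1, m)) (Qc : 'M[R]_(n.+1, nc)) (Qu : 'M[R]_(n.+1, nu)).
Hypothesis kal : is_orthogonal_kalman A B Qc Qu.
Local Notation toC := (real_complex R).
Local Notation normc := Normc.normc.
Local Notation Au := (uncontrollable_block A Qu).

Lemma has_deriv_mulmx_expmx p (Y : 'M[R]_(p, n.+1)) (M : 'M[R]_n.+1) i j :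
  has_deriv (fun t => (Y *m expmx (t *: M)) i j) (fun t => (Y *m M *m expmx (t *: M)) i j).
Proof.
move=> t; rewrite (_ : (fun _ => _) = fun u => \sum_k Y i k * expmx (u *: M) k j); last first.
  by apply/funext => u; rewrite mxE.
apply: (eq_has_deriv (dg := fun u => (Y *m M *m expmx (u *: M)) i j) (has_deriv_sum _
  (fun k => has_derivZ (Y i k) (has_deriv_expmx M k j)))) => u.
by rewrite -mulmxA [RHS]mxE.
Qed.

(** Left Jordan chains of the uncontrollable block, seen through [Qu^T], are
    left Jordan chains of every closed loop. *)
Lemma uncontrollable_chain (K : 'M[R]_(m, n.+1)) s (l : R[i]) (L : 'M[R[i]]_(s, nu))
    q (v : 'M[R[i]]_(n.+1, q)) y k t :
  L *m map_mx toC Au = jordan_block l s *m L -> (k <= s)%N ->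
  (chain_row L k *m map_mx toC Qu^T *m map_mx toC (expmx (t *: (A + B *m K))) *m v) 0 y =
    expC l t * \sum_(j < s - k) (t ^+ j / j`!%:R)%:C *
       (chain_row L (k + j) *m map_mx toC Qu^T *m v) 0 y.
Proof.
move=> LA ks; apply: (jordan_chain_expmx (w := fun k => chain_row L k *m map_mx toC Qu^T)) => //.
  move=> k' k's; rewrite -mulmxA -map_mxM (kalman_closed_loop kal) map_mxM mulmxA.
  by rewrite (chain_row_mulmx LA k's) mulmxDl scalemxAl.
by rewrite chain_row_out// mul0mx.
Qed.

Variables (r : nat) (l : 'I_r -> R[i]) (s : 'I_r -> nat).
Hypothesis jf : is_jordan_form (map_mx toC Au) l s.

Lemma normc_bilinear_le_opnorm (w : 'rV[R[i]]_n.+1) q (v : 'M[R[i]]_(n.+1, q)) y (X : 'M[R]_n.+1) :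
  normc ((w *m map_mx toC X *m v) 0 y) <=
    (\sum_j \sum_i normc (w 0 i) * normc (v j y)) * opnorm X.
Proof.
rewrite mxE (le_trans (normc_sum _ _ _))// mulr_suml; apply: ler_sum => j _.
rewrite mxE Normc.normcM -mulr_suml mulrAC ler_wpM2r ?normc_ge0//.
rewrite (le_trans (normc_sum _ _ _))// mulr_suml; apply: ler_sum => i _.
by rewrite mxE Normc.normcM normc_real ler_wpM2l ?normc_ge0// entry_le_opnorm.
Qed.

(** Testing the exponential against the first row of the left chain and the last
    column of the right chain of block [i] isolates the term of highest degree,
    t^p / p! exp (l t). Both test vectors are independent of [K], hence so is
    the constant. *)
Lemma growth_lower_bound i p : s i = p.+1 ->
  exists2 c : R, 0 < c & forall K t, 0 <= t ->
    c * (t ^+ p * expR (complex.Re (l i) * t)) <= opnorm (expmx (t *: (A + B *m K))).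
Proof.
move=> sip; have [L [T [LM _ LT _]]] := jordan_form_blocks jf.
have ps : (p < s i)%N by rewrite sip.
pose y : 'I_(s i) := Ordinal ps.
pose w := chain_row (L i) 0 *m map_mx toC Qu^T.
pose v := map_mx toC Qu *m T i.
set N := \sum_j \sum_i normc (w 0 i) * normc (v j y).
have N0 : 0 <= N by do 2 (apply: sumr_ge0 => ? _); rewrite mulr_ge0 ?normc_ge0.
have N1 : 0 < N + 1 by rewrite ltr_wpDl.
exists ((p`!%:R)^-1 / (N + 1)).
  by rewrite divr_gt0// invr_gt0 ltr0n fact_gt0.
move=> K t t0; set X := expmx _.
have X0 : 0 <= opnorm X by rewrite (le_trans _ (entry_le_opnorm X 0 0)).
have E : (w *m map_mx toC X *m v) 0 y = expC (l i) t * (t ^+ p / p`!%:R)%:C.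
  rewrite (uncontrollable_chain K v y t (LM i) (leq0n _)) subn0; congr (_ * _).
  have wv j : (chain_row (L i) j *m map_mx toC Qu^T *m v) 0 y = (j == p)%:R.
    rewrite /v -mulmxA [map_mx toC Qu^T *m _]mulmxA -map_mxM (kalman_orthonormal kal).
    rewrite map_mx1 mul1mx; have [js|sj] := ltnP j (s i).
      by rewrite (chain_row_ord _ (Ordinal js)) -row_mul LT !mxE -val_eqE.
    rewrite chain_row_out// mul0mx mxE (_ : _ == _ = false)//.
    by apply/eqP => jp; move: sj; rewrite jp leqNgt ps.
  rewrite (bigD1 y)//= wv eqxx mulr1 big1 ?addr0// => j jy.
  by rewrite wv (_ : _ == _ = false) ?mulr0//; apply: negbTE; move: jy; rewrite -val_eqE.
have := normc_bilinear_le_opnorm w v y X.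
rewrite E Normc.normcM normc_expC normc_real -/N ger0_norm ?divr_ge0 ?exprn_ge0// => H.
rewrite mulrAC ler_pdivrMr//; apply: (@le_trans _ _ (N * opnorm X)); last first.
  by rewrite mulrC ler_wpM2l// lerDl.
by apply: le_trans H; rewrite mulrC [t ^+ p * _]mulrC -mulrA.
Qed.

(** Block [i] contributes (1 + t)^(s_i - 1) exp (Re l_i t) at most, and a block
    of any size is negligible when Re l_i < a. *)
Lemma uncontrollable_component_dominated p (a : R) (K : 'M[R]_(m, n.+1)) x y :
  (forall i, complex.Re (l i) < a \/ complex.Re (l i) = a /\ ((s i).-1 <= p)%N) ->
  dominated (poly_exp p a) (fun t => (Qu^T *m expmx (t *: (A + B *m K))) x y).
Proof.
move=> la; have [L [T [LM _ _ TL]]] := jordan_form_blocks jf.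
have pe0 t : 0 <= t -> 0 <= poly_exp p a t by exact: poly_exp_ge0.
pose phi i (k : 'I_(s i)) t := (chain_row (L i) k *m map_mx toC Qu^T *m
     map_mx toC (expmx (t *: (A + B *m K)))) 0 y.
have phiE i k t : phi i k t = expC (l i) t * \sum_(j < s i - k) (t ^+ j / j`!%:R)%:C *
    (chain_row (L i) (k + j) *m map_mx toC Qu^T) 0 y.
  have := @uncontrollable_chain K _ _ _ _ 1%:M y k t (LM i) (ltnW (ltn_ord k)).
  rewrite mulmx1 /phi => ->; congr (_ * _); apply: eq_bigr => j _.
  by rewrite mulmx1.
have phi_dom i k : dominated (poly_exp p a) (fun t => normc (phi i k t)).
  apply: (dominated_le (f := fun t => \sum_(j < s i - k)
     normc ((chain_row (L i) (k + j) *m map_mx toC Qu^T) 0 y) *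
       poly_exp (s i).-1 (complex.Re (l i)) t)).
    apply: dominated_sum => // j; apply: dominatedZ; exact: poly_exp_dominated.
  move=> t t0; rewrite phiE Normc.normcM normc_expC.
  rewrite !ger0_norm ?mulr_ge0 ?expR_ge0 ?normc_ge0//; last first.
    by apply: sumr_ge0 => j _; rewrite mulr_ge0 ?normc_ge0 ?poly_exp_ge0.
  rewrite mulrC -ler_pdivlMr ?expR_gt0// (le_trans (normc_sum _ _ _))// mulr_suml.
  apply: ler_sum => j _; rewrite Normc.normcM normc_real mulrC -mulrA ler_wpM2l ?normc_ge0//.
  rewrite /poly_exp mulfK ?gt_eqF ?expR_gt0// ger0_norm ?divr_ge0 ?exprn_ge0//.
  rewrite ler_pdivrMr ?ltr0n ?fact_gt0//.
  apply: (@le_trans _ _ ((1 + t) ^+ (s i).-1)); last first.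
    by rewrite ler_peMr ?exprn_ge0 ?addr_ge0// ler1n fact_gt0.
  apply: (@le_trans _ _ ((1 + t) ^+ j)); first by rewrite lerXn2r ?nnegrE ?addr_ge0 ?lerDr.
  rewrite ler_weXn2l ?lerDl//.
  have js : (j < s i)%N := leq_trans (ltn_ord j) (leq_subr _ _).
  by rewrite -ltnS prednK // (leq_ltn_trans _ js).
apply: (dominated_le (f := fun t => \sum_i \sum_k normc (T i x k) * normc (phi i k t))).
  apply: dominated_sum => // i; apply: dominated_sum => // k; exact: dominatedZ.
move=> t t0; rewrite [leRHS]ger0_norm; last first.
  by do 2 (apply: sumr_ge0 => ? _); rewrite mulr_ge0 ?normc_ge0.
set X := expmx _.
have E : map_mx toC (Qu^T *m X) = \sum_i T i *m (L i *m map_mx toC Qu^T *m map_mx toC X).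
  rewrite map_mxM -[LHS]mul1mx -TL mulmx_suml; apply: eq_bigr => i _.
  by rewrite !mulmxA.
have -> : `|(Qu^T *m X) x y| = normc (map_mx toC (Qu^T *m X) x y).
  by rewrite [in RHS]mxE normc_real.
rewrite E summxE (le_trans (normc_sum _ _ _))//; apply: ler_sum => i _.
rewrite mxE (le_trans (normc_sum _ _ _))//; apply: ler_sum => k _.
rewrite Normc.normcM ler_wpM2l ?normc_ge0// /phi chain_row_ord -!row_mul.
by rewrite [(row _ _) 0 y]mxE.
Qed.

(** The exponential splits as V (V' H X) + Qu (Qu^T X), where H is the projection
    onto the reachable subspace. The second component is dominated whatever the
    feedback; the first one satisfies a diagonal system forced by the second. *)
Lemma growth_upper_bound p (a : R) :
  (forall i, complex.Re (l i) < a \/ complex.Re (l i) = a /\ ((s i).-1 <= p)%N) ->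
  exists K : 'M[R]_(m, n.+1),
    dominated (poly_exp p a) (fun t => opnorm (expmx (t *: (A + B *m K)))).
Proof.
move=> la; have pe0 t : 0 <= t -> 0 <= poly_exp p a t by exact: poly_exp_ge0.
have QQ := kalman_orthonormal kal.
have [K [k [V [V' [d [da MV V'V QV VH]]]]]] := assign_reachable_eigenvalues (a - 1) QQ
  (kalman_invariant kal) (kalman_input kal) (kalman_kernel kal).
(* The reachable modes are placed at distance at least 1 below [a], which is
   what the comparison for scalar equations requires. *)
exists K; set M := A + B *m K in MV *; pose H := 1%:M - Qu *m Qu^T.
pose F := V' *m H *m M *m Qu.
have bdom x y : dominated (poly_exp p a) (fun t => (Qu^T *m expmx (t *: M)) x y).
  exact: uncontrollable_component_dominated.
have split t : expmx (t *: M) = V *m (V' *m H *m expmx (t *: M)) + Qu *m (Qu^T *m expmx (t *: M)).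
  by rewrite !mulmxA -mulmxDl VH subrK mul1mx.
have HV : H *m V = V by rewrite mulmxBl mul1mx -mulmxA QV mulmx0 subr0.
have aE : V' *m H *m M = diag_mx d *m (V' *m H) + F *m Qu^T.
  have HE : 1%:M = V *m (V' *m H) + Qu *m Qu^T by rewrite mulmxA VH subrK.
  rewrite -[LHS]mulmx1 HE mulmxDr; congr (_ + _); last by rewrite /F !mulmxA.
  rewrite mulmxA -[_ *m M *m V]mulmxA MV !mulmxA; congr (_ *m _ *m _).
  by rewrite -[V' *m H *m V]mulmxA HV V'V mul1mx.
have adom x y : dominated (poly_exp p a) (fun t => (V' *m H *m expmx (t *: M)) x y).
  apply: (linear_ode_dominated (da x) (g := fun t => \sum_z F x z * (Qu^T *m expmx (t *: M)) z y)).
    apply: (eq_has_deriv (has_deriv_mulmx_expmx (V' *m H) M x y)) => t.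
    rewrite aE mulmxDl mxE -[diag_mx d *m _ *m _]mulmxA -[F *m _ *m _]mulmxA mul_diag_mx [X in X + _]mxE; congr (_ + _).
    by rewrite [LHS]mxE.
  by apply: dominated_sum => // z; exact: dominatedZ.
apply: (dominated_le (f := fun t => \sum_x \sum_y `|expmx (t *: M) x y|)).
  apply: dominated_sum => // x; apply: dominated_sum => // y.
  apply: (dominated_le (f := fun t => \sum_z V x z * (V' *m H *m expmx (t *: M)) z y +
     \sum_z Qu x z * (Qu^T *m expmx (t *: M)) z y)).
    by apply: dominatedD; apply: dominated_sum => // z; exact: dominatedZ.
  by move=> t t0; rewrite normr_id {1}split mxE [X in `|X + _|]mxE [X in `|_ + X|]mxE.
move=> t t0; rewrite [leRHS]ger0_norm ?ger0_norm; first exact: opnorm_le_sum.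
  by rewrite (le_trans _ (entry_le_opnorm _ 0 0)).
by do 2 (apply: sumr_ge0 => ? _).
Qed.

End Growth.

(** * Asymptotics of the optimal prefactor *)

Section Asymptotics.
Variable R : realType.

(** The bounds give |ln f(d) - p ln (1/e)| <= |ln c| + |ln C| with e = delta - d;
    divided by ln (1/e), which tends to infinity, the error vanishes. *)
Lemma log_ratio_cvg (f : R -> \bar R) (delta c C e0 : R) p :
  0 < delta -> 0 < c -> 0 < C -> 0 < e0 ->
  (forall d, 0 < d -> 0 < delta - d <= e0 ->
    ((c * (delta - d) ^- p)%:E <= f d <= (C * (delta - d) ^- p)%:E)%E) ->
  (lne (f d) / lne ((delta - d)^-1)%:E)%E @[d --> delta^'-] --> (p%:R : R)%:E.
Proof.
move=> delta0 c0 C0 e00 fb.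
have real d : 0 < d -> 0 < delta - d -> delta - d <= e0 -> delta - d < 1 ->
    exists2 x : R, (lne (f d) / lne ((delta - d)^-1)%:E)%E = x%:E &
      `|p%:R - x| * - ln (delta - d) <= `|ln c| + `|ln C|.
  move=> d0; set e := delta - d => e1 e2 e3.
  have /andP[f1 f2] : ((c * e ^- p)%:E <= f d <= (C * e ^- p)%:E)%E by apply: fb; rewrite ?e1.
  have [y fy] : exists y, f d = y%:E.
    by exists (fine (f d)); rewrite fineK// fin_numE; case: (f d) f1 f2.
  have ep : 0 < e ^- p by rewrite invr_gt0 exprn_gt0.
  rewrite fy !lee_fin in f1 f2 *.
  have y0 : 0 < y by rewrite (lt_le_trans _ f1)// mulr_gt0.
  have L0 : 0 < - ln e by rewrite oppr_gt0 ln_lt0// e1.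
  exists (ln y / - ln e).
    rewrite !lne_EFin ?invr_gt0// lnV ?posrE// inver oppr_eq0.
    by rewrite -oppr_eq0 gt_eqF.
  rewrite -{2}(gtr0_norm L0) -normrM mulrBl divfK ?gt_eqF//.
  have lnep : ln (e ^- p) = p%:R * - ln e.
    by rewrite lnV ?posrE ?exprn_gt0// lnXn// mulrN mulr_natl.
  have H1 : ln c + p%:R * - ln e <= ln y.
    by rewrite -lnep -lnM ?posrE// ler_ln ?posrE ?mulr_gt0.
  have H2 : ln y <= ln C + p%:R * - ln e.
    by rewrite -lnep -lnM ?posrE// ler_ln ?posrE ?mulr_gt0.
  have := ler_norm (ln C); have := ler_norm (- ln c); rewrite normrN => N1 N2.
  have := normr_ge0 (ln c); have := normr_ge0 (ln C) => N3 N4.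
  by rewrite ler_norml; apply/andP; split; lra.
have pos_near : \forall d \near delta^'-, 0 < d by exact: nbhs_left_gt.
have lt_near : \forall d \near delta^'-, d < delta by exact: nbhs_left_lt.
have close e : 0 < e -> \forall d \near delta^'-, delta - d < e.
  move=> e1; have : \forall d \near delta^'-, delta - e < d.
    by apply: nbhs_left_gt; rewrite ltrBlDr ltrDl.
  by apply: filterS => d; rewrite !ltrBlDr addrC.
apply: cvg_EFin.
  near=> d; have [||||x -> _ //] := real d; rewrite ?subr_gt0; near: d => //.
  - by have := close _ e00; apply: filterS => d /ltW.
  - exact: close.
apply/cvgrPdist_le => eta eta0; pose M := `|ln c| + `|ln C|.
near=> d.
have d0 : 0 < d by near: d.
have d1 : 0 < delta - d by rewrite subr_gt0; near: d.
have d2 : delta - d <= e0 by apply/ltW; near: d; exact: close.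
have d3 : delta - d < 1 by near: d; exact: close.
have d4 : delta - d < expR (- (M / eta)) by near: d; apply: close; exact: expR_gt0.
have [x /= -> H] := real d d0 d1 d2 d3; rewrite /=.
have L : M / eta <= - ln (delta - d).
  by rewrite lerNr -ler_expR lnK ?posrE// ltW.
have L0 : 0 < - ln (delta - d) by rewrite oppr_gt0 ln_lt0// d1.
rewrite -(ler_pM2r L0) (le_trans H)// -/M mulrC -ler_pdivrMr//.
Unshelve. all: by end_near. Qed.

Variables (n m : nat) (A : 'M[R]_n.+1) (B : 'M[R]_(n.+1, m)) (a : R) (p : nat).

Lemma decay_prefactor_ge d (M : 'M[R]_n.+1) t : 0 <= t ->
  ((expR (d * t) * opnorm (expmx (t *: M)))%:E <= decay_prefactor d M)%E.
Proof. by move=> t0; apply: ereal_sup_ubound; exists t. Qed.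

Section Lower.
Variable c : R.
Hypothesis c0 : 0 < c.
Hypothesis low : forall (K : 'M[R]_(m, n.+1)) t, 0 <= t ->
  c * (t ^+ p * expR (a * t)) <= opnorm (expmx (t *: (A + B *m K))).

(** The supremum over t is bounded below by its value at t = 1 / e, where
    e = - a - d; up to a factor depending on p only, t^p exp (- e t) is maximal
    there. *)
Lemma opt_prefactor_lower d : 0 < - a - d ->
  ((c * expR (-1) * (- a - d) ^- p)%:E <= opt_prefactor A B d)%E.
Proof.
set e := - a - d => e0; apply/ereal_infP => _ [K _ <-].
have ei : 0 <= e^-1 by rewrite invr_ge0 ltW.
apply: le_trans (decay_prefactor_ge d _ ei); rewrite lee_fin.
apply: (@le_trans _ _ (expR (d * e^-1) * (c * (e^-1 ^+ p * expR (a * e^-1))))).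
  have -> : expR (-1) = expR (d * e^-1) * expR (a * e^-1).
    by rewrite -expRD -mulrDl (_ : d + a = - e) ?mulNr ?divff ?gt_eqF// /e; ring.
  by rewrite exprVn le_eqVlt; apply/orP; left; apply/eqP; ring.
by rewrite ler_wpM2l ?expR_ge0// low.
Qed.

(** In both cases t^p exp ((d + a) t) grows at least linearly in t. *)
Lemma decay_prefactor_infinite d K : - a < d \/ d = - a /\ (0 < p)%N ->
  decay_prefactor d (A + B *m K) = +oo%E.
Proof.
move=> da.
have [g g0 gt] : exists2 g : R, 0 < g & forall t, 1 <= t ->
    g * t <= c * (t ^+ p * expR ((d + a) * t)).
  case: da => [ad|[-> p0]].
    exists (c * (d + a)); first by rewrite mulr_gt0//; lra.
    move=> t t1; rewrite -mulrA ler_wpM2l ?(ltW c0)//.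
    apply: (@le_trans _ _ (expR ((d + a) * t))); last by rewrite ler_peMl ?expR_ge0// exprn_ege1.
    by apply: le_trans (expR_ge1Dx _); rewrite lerDr.
  exists c => // t t1; rewrite addNr mul0r expR0 mulr1 ler_wpM2l ?(ltW c0)//.
  by rewrite -[leLHS]expr1 ler_weXn2l.
apply/eqyP => X X0; pose t := Num.max 1 (X / g).
have t1 : 1 <= t by rewrite le_max lexx.
have t0 : 0 <= t by rewrite (le_trans _ t1).
apply: le_trans (decay_prefactor_ge d _ t0); rewrite lee_fin.
apply: (@le_trans _ _ (g * t)); first by rewrite mulrC -ler_pdivrMr// le_max lexx orbT.
apply: (le_trans (gt _ t1)).
apply: (@le_trans _ _ (expR (d * t) * (c * (t ^+ p * expR (a * t))))).
  by rewrite mulrDl expRD le_eqVlt; apply/orP; left; apply/eqP; ring.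
by rewrite ler_wpM2l ?expR_ge0// low.
Qed.

Lemma opt_prefactor_infinite d : - a < d \/ d = - a /\ (0 < p)%N ->
  opt_prefactor A B d = +oo%E.
Proof.
move=> da; apply/eqP; rewrite -leye_eq; apply/ereal_infP => _ [K _ <-].
by rewrite decay_prefactor_infinite.
Qed.

End Lower.

Section Upper.
Variable K : 'M[R]_(m, n.+1).
Hypothesis up : dominated (poly_exp p a) (fun t => opnorm (expmx (t *: (A + B *m K)))).

Lemma opt_prefactor_upper : exists2 C : R, 0 < C & forall d, 0 < - a - d <= 1 ->
  (opt_prefactor A B d <= (C * (- a - d) ^- p)%:E)%E.
Proof.
have [C C0 XC] := up; pose N : R := p.+1%:R ^+ p.+1.
have N0 : 0 <= N by exact: exprn_ge0.
exists (C * N + 1); first by rewrite ltr_wpDl// mulr_ge0.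
move=> d; set e := - a - d => /andP[e0 e1]; apply: ge_ereal_inf.
exists (decay_prefactor d (A + B *m K)); first by exists K.
apply: ge_ereal_sup => _ [t t0 <-]; rewrite lee_fin.
have ep : 0 <= e ^- p by rewrite invr_ge0 exprn_ge0// ltW.
apply: (@le_trans _ _ (expR (d * t) * (C * poly_exp p a t))).
  by rewrite ler_wpM2l ?expR_ge0// (le_trans (ler_norm _))// XC.
apply: (@le_trans _ _ (expR (d * t) * (C * (N * e ^- p * expR (e * t) * expR (a * t))))).
  rewrite ler_wpM2l ?expR_ge0// ler_wpM2l// ler_wpM2r ?expR_ge0//.
  exact: polynomial_le_exp.
have -> : expR (d * t) * (C * (N * e ^- p * expR (e * t) * expR (a * t))) =
   C * N * e ^- p * (expR (d * t) * expR (e * t) * expR (a * t)) by ring.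
rewrite -!expRD (_ : _ + _ = 0) ?expR0 ?mulr1; last by rewrite /e; ring.
by rewrite ler_wpM2r// lerDl.
Qed.

Lemma decay_prefactor_endpoint : p = 0%N -> (decay_prefactor (- a) (A + B *m K) < +oo)%E.
Proof.
move=> p0; have [C C0 XC] := up; apply: (@le_lt_trans _ _ C%:E); last exact: ltry.
apply: ge_ereal_sup => _ [t t0 <-]; rewrite lee_fin.
apply: (@le_trans _ _ (expR (- a * t) * (C * poly_exp p a t))).
  by rewrite ler_wpM2l ?expR_ge0// (le_trans (ler_norm _))// XC.
by rewrite /poly_exp p0 expr0 mul1r mulrCA -expRD mulNr addNr expR0 mulr1.
Qed.

End Upper.
End Asymptotics.

Section Main.
Variables (R : realType) (n m : nat) (A : 'M[R]_n.+1) (B : 'M[R]_(n.+1, m)).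

(** The conclusion of the theorem as a property of the rate and the exponent, to
    be compared between different decompositions. *)
Definition prefactor_law (dstar : R) (q : nat) (c0 C0 e0 : R) :=
  [/\ 0 < dstar,
      forall d : R, 0 < d -> 0 < dstar - d <= e0 ->
        ((c0 * (dstar - d) ^- (q - 1))%:E <= opt_prefactor A B d
           <= (C0 * (dstar - d) ^- (q - 1))%:E)%E,
      (lne (opt_prefactor A B d) / lne ((dstar - d)^-1)%:E)%E
        @[d --> dstar^'-] --> (q%:R - 1)%:E,
      achievable A B dstar <-> q = 1%N
    & (opt_prefactor A B dstar < +oo)%E <-> q = 1%N].

(** The optimal prefactor is finite just below [dstar] and infinite above: this
    characterizes a positive [dstar] by (A, B) alone. *)
Definition is_critical_rate (dstar : R) :=
  (forall d, dstar < d -> opt_prefactor A B d = +oo%E) /\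
  (forall d, 0 < d -> 0 < dstar - d <= 1 -> (opt_prefactor A B d < +oo)%E).

Lemma critical_rate_le x y : 0 < y -> is_critical_rate x -> is_critical_rate y -> y <= x.
Proof.
move=> y0 [xoo _] [_ yfin]; rewrite leNgt; apply/negP => xy.
pose w := Num.max (Num.max x 0) (y - 1).
have wy : w < y by rewrite !gt_max xy y0 ltrBlDr ltrDl ltr01.
have [xw w0 yw] : [/\ x <= w, 0 <= w & y - 1 <= w].
  by rewrite /w !le_max !lexx !orbT.
have := yfin ((w + y) / 2); rewrite xoo ?ltxx; last lra.
have -> : 0 < (w + y) / 2 by lra.
have -> : 0 < y - (w + y) / 2 by lra.
have -> : y - (w + y) / 2 <= 1 by lra.
by move=> /(_ isT isT).
Qed.

Lemma jordan_prefactor_law nc nu (Qc : 'M[R]_(n.+1, nc)) (Qu : 'M[R]_(n.+1, nu))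
    r (l : 'I_r -> R[i]) (s : 'I_r -> nat) :
  stabilizable A B -> ~ controllable A B -> is_orthogonal_kalman A B Qc Qu ->
  is_jordan_form (map_mx (real_complex R) (uncontrollable_block A Qu)) l s ->
  let dstar := - spectral_abscissa (uncontrollable_block A Qu) in
  let q := max_block_size l s (- dstar) in
  exists c0 C0, [/\ 0 < c0, 0 < C0, is_critical_rate dstar & prefactor_law dstar q c0 C0 1].
Proof.
move=> [K stabK] nctrl kal jf; set a := spectral_abscissa _ => dstar q.
have nu0 := kalman_uncontrollable_dim kal nctrl.
have [[i0 i0a] la] : (exists i, complex.Re (l i) = a) /\ (forall i, complex.Re (l i) <= a).
  rewrite /a; clear a dstar q; case: nu nu0 Qu kal jf => // nu' _ Qu' kal' jf'.
  exact: (jordan_spectral_abscissa jf').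
have qE : q = \max_(i < r | complex.Re (l i) == a) s i by rewrite /q /dstar opprK.
have [i1 /eqP i1a i1q] : {i1 | complex.Re (l i1) == a & q = s i1}.
  by rewrite qE; apply: eq_bigmax_cond; apply/card_gt0P; exists i0; apply/eqP.
have sq i : complex.Re (l i) = a -> (s i <= q)%N.
  by move=> ia; rewrite qE; apply: (leq_bigmax_cond (F := s)); apply/eqP.
have q0 : (0 < q)%N by rewrite i1q; case: jf.
pose p := (q - 1)%N; have qp : q = p.+1 by rewrite /p subn1 prednK.
have a0 : a < 0.
  have : eigenvalue (map_mx (real_complex R) (uncontrollable_block A Qu)) (l i0).
    by apply/(jordan_form_eigenvalue _ jf); exists i0.
  case/eigenvalueP => v vA v0; rewrite -i0a; apply: (stabK (l i0)).
  apply/eigenvalueP; exists (v *m map_mx (real_complex R) Qu^T).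
    by rewrite -mulmxA -map_mxM (kalman_closed_loop kal) map_mxM mulmxA vA -scalemxAl.
  apply: contra v0 => /eqP v0; rewrite -[v]mulmx1 -(map_mx1 (real_complex R)).
  by rewrite -(kalman_orthonormal kal) map_mxM mulmxA v0 mul0mx.
have dstar0 : 0 < dstar by rewrite oppr_gt0.
have [c c0 low] : exists2 c : R, 0 < c & forall (K : 'M[R]_(m, n.+1)) t, 0 <= t ->
    c * (t ^+ p * expR (a * t)) <= opnorm (expmx (t *: (A + B *m K))).
  rewrite -i1a; apply: (growth_lower_bound kal jf); by rewrite -i1q.
have [K1 up] : exists K : 'M[R]_(m, n.+1),
    dominated (poly_exp p a) (fun t => opnorm (expmx (t *: (A + B *m K)))).
  apply: (growth_upper_bound kal jf) => i.
  have [ia|ia] := eqVneq (complex.Re (l i)) a; last by left; rewrite lt_neqAle ia la.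
  by right; split=> //; rewrite /p -subn1 leq_sub2r// sq.
have [C C0 upC] := opt_prefactor_upper up.
have bounds d : 0 < d -> 0 < dstar - d <= 1 ->
   ((c * expR (-1) * (dstar - d) ^- p)%:E <= opt_prefactor A B d
           <= (C * (dstar - d) ^- p)%:E)%E.
  move=> _ /andP[d0 d1]; apply/andP; split; first exact: (opt_prefactor_lower low d0).
  by apply: upC; rewrite d0.
have ce0 : 0 < c * expR (-1) by rewrite mulr_gt0 ?expR_gt0.
exists (c * expR (-1)), C; split=> //.
  split=> [d ad|d d0 d1]; first by apply: (opt_prefactor_infinite c0 low); left.
  by have /andP[_ H] := bounds d d0 d1; rewrite (le_lt_trans H)// ltry.
have q1 : p = 0%N -> q = 1%N by rewrite qp => ->.
have p1 : q = 1%N -> p = 0%N by rewrite qp => -[].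
have pinf : q <> 1%N -> (0 < p)%N by rewrite lt0n => q1'; apply/eqP => /q1.
split=> //.
- have -> : q%:R - 1 = p%:R :> R by rewrite qp -natr1 addrK.
  exact: (log_ratio_cvg dstar0 ce0 C0 ltr01 bounds).
- split=> [[K' K'fin]|/p1 p0]; last by exists K1; exact: (decay_prefactor_endpoint up p0).
  apply/eqP; apply: contraT => /eqP/pinf p0.
  by rewrite (decay_prefactor_infinite c0 low) ?ltxx// in K'fin; right.
- split=> [fin|/p1 p0]; last first.
    apply: le_lt_trans (decay_prefactor_endpoint up p0).
    by apply: ereal_inf_lbound; exists K1.
  apply/eqP; apply: contraT => /eqP/pinf p0.
  by rewrite (opt_prefactor_infinite c0 low) ?ltxx// in fin; right.
Qed.

End Main.

(** * Independence of the decomposition, and the theorem *)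

Section Uniqueness.
Variables (R : realType) (n m : nat) (A : 'M[R]_n.+1) (B : 'M[R]_(n.+1, m)).

(** The critical rate is unique, and then the exponent is read off the limit. *)
Lemma prefactor_law_unique (x y : R) q q' c0 C0 e0 c0' C0' e0' :
  prefactor_law A B x q c0 C0 e0 -> is_critical_rate A B x ->
  prefactor_law A B y q' c0' C0' e0' -> is_critical_rate A B y ->
  x = y /\ q = q'.
Proof.
move=> [x0 _ xlim _ _] cx [y0 _ ylim _ _] cy.
have xy : x = y by apply/eqP; rewrite eq_le !(@critical_rate_le _ _ _ A B _ _ _ _ _).
split=> //; rewrite -xy in ylim.
have : (q%:R - 1)%:E = (q'%:R - 1)%:E :> \bar R.
  exact: (cvg_unique (@ereal_hausdorff R) xlim ylim).
by move=> [] /addIr /eqP; rewrite eqr_nat => /eqP.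
Qed.

End Uniqueness.

Theorem theorem2 (R : realType) (n m : nat)
    (A : 'M[R]_n) (B : 'M[R]_(n, m))
    (hstab : stabilizable A B) (hctrl : ~ controllable A B) :
  exists c0 C0 e0 : R,
    [/\ 0 < c0, 0 < C0, 0 < e0 &
    forall (nc nu : nat) (Qc : 'M[R]_(n, nc)) (Qu : 'M[R]_(n, nu)),
      is_orthogonal_kalman A B Qc Qu ->
    let Au := uncontrollable_block A Qu in
    let dstar := - spectral_abscissa Au in
    forall (r : nat) (l : 'I_r -> R[i]) (s : 'I_r -> nat),
      is_jordan_form (map_mx (real_complex R) Au) l s ->
    let q := max_block_size l s (- dstar) in
    [/\ 0 < dstar,
        forall d : R, 0 < d -> 0 < dstar - d <= e0 ->
          ((c0 * (dstar - d) ^- (q - 1))%:E <= opt_prefactor A B d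
             <= (C0 * (dstar - d) ^- (q - 1))%:E)%E,
        (lne (opt_prefactor A B d) / lne ((dstar - d)^-1)%:E)%E
          @[d --> dstar^'-] --> (q%:R - 1)%:E,
        achievable A B dstar <-> q = 1%N
      & (opt_prefactor A B dstar < +oo)%E <-> q = 1%N]].
Proof.
move: A B hstab hctrl; case: n => [|n] A B hstab hctrl.
  by case: hctrl; apply/eqP; rewrite -leqn0 rank_leq_row.
have law := jordan_prefactor_law hstab hctrl.
(* One decomposition and one Jordan form supply the constants for all others;
   if there is none, the claim is vacuous. *)
have [[nc [nu [Qc [Qu [kal [r [l [s jf]]]]]]]]|none] := pselect (exists nc nu
    (Qc : 'M[R]_(n.+1, nc)) (Qu : 'M[R]_(n.+1, nu)), is_orthogonal_kalman A B Qc Qu /\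
    exists r (l : 'I_r -> R[i]) (s : 'I_r -> nat),
      is_jordan_form (map_mx (real_complex R) (uncontrollable_block A Qu)) l s); last first.
  exists 1, 1, 1; split=> // nc nu Qc Qu kal Au dstar r l s jf.
  by case: none; exists nc, nu, Qc, Qu; split=> //; exists r, l, s.
have [c0 [C0 [c0_gt0 C0_gt0 crit lawQ]]] := law _ _ _ _ _ _ _ kal jf.
exists c0, C0, 1; split=> // nc' nu' Qc' Qu' kal' Au dstar r' l' s' jf' q.
have [c1 [C1 [_ _ crit' lawQ']]] := law _ _ _ _ _ _ _ kal' jf'.
have [dE qE] := prefactor_law_unique lawQ crit lawQ' crit'.
by move: lawQ; rewrite qE dE.
Qed.
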